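(* Let $\theta_1,\theta_2$ be real-valued functions on $(0,1)$ and put $\rho_i(t)=te^{\theta_i(t)}$, $t\in(0,1)$, $i=1,2$. Assume that $\rho_1$ is continuous and nondecreasing, that there is a constant $C>0$ with $\rho_1(t)\le Ct$ for all $t\in(0,1)$, that $$\int_0\frac{\rho_1(t)\,dt}{t^2}=\infty,$$ and that $\rho_1(t)/\rho_2(t)\to\infty$ as $t\to0$. Then $\Lambda_{\theta_1}\neq\Lambda_{\theta_2}$. Moreover, there exists a separated sequence $\{z_k\}\subset\mathbb{D}$ such that $\{z_k\}\notin\Lambda_{\theta_1}$, but $$\sum_k\rho_2(1-|z_k|)\,|f(z_k)|<\infty\quad\text{for every } f\in H^\infty .$$
   Context: $\mathbb{D}=\{z\in\mathbb{C}:|z|<1\}$, and $H^\infty$ is the space of bounded holomorphic functions on $\mathbb{D}$. All sequences $\{z_k\}\subset\mathbb{D}$ are infinite and satisfy $|z_k|\to1$. A sequence $\{z_k\}$ is separated if $\inf_{n\neq k}\left|\frac{z_n-z_k}{1-\overline{z}_n z_k}\right|>0$. For a real-valued function $\theta$ on $(0,1)$, a sequence $\{z_k\}$ is $\theta$-thin if there exists $f\in H^\infty$, $f\not\equiv0$, with $\sum_k(1-|z_k|)e^{\theta(1-|z_k|)}|f(z_k)|<\infty$. $\Lambda_\theta$ denotes the class of all separated $\theta$-thin sequences. In all such sums, if some $z_k=0$, the corresponding term is omitted. $\int_0 g(t)\,dt=\infty$ means that $\int_0^{\varepsilon}g(t)\,dt=\infty$ for small $\varepsilon\in(0,1)$.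 *)

(* Defs.v *)
From Stdlib Require Import Reals.
From Coquelicot Require Import Coquelicot.

Open Scope R_scope.

Definition in_disk (z : C) : Prop := Cmod z < 1.

Definition holomorphic_disk (f : C -> C) : Prop :=
  forall z : C, in_disk z -> ex_derive (K := C_AbsRing) (V := C_NormedModule) f z.

(* An element of H^infty is represented by a total function whose values
   outside the open unit disk are irrelevant. *)
Definition H_infty (f : C -> C) : Prop :=
  holomorphic_disk f /\
  exists M : R, forall z : C, in_disk z -> Cmod (f z) <= M.

Definition not_identically_zero (f : C -> C) : Prop :=
  exists z : C, in_disk z /\ f z <> RtoC 0.

Definition disk_sequence (z : nat -> C) : Prop :=
  (forall k : nat, in_disk (z k)) /\ is_lim_seq (fun k => Cmod (z k)) 1.

Definition pseudo_dist (a b : C) : R :=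
  Cmod ((a - b) / (RtoC 1 - Cconj a * b))%C.

Definition separated (z : nat -> C) : Prop :=
  Rbar_lt 0
    (Glb_Rbar (fun d : R =>
       exists n k : nat, n <> k /\ d = pseudo_dist (z n) (z k))).

Definition rho (theta : R -> R) (t : R) : R := t * exp (theta t).

(* Terms with [z k = 0] are omitted, so [theta] is only evaluated on (0,1). *)
Definition weighted_term (theta : R -> R) (f : C -> C) (z : nat -> C) (k : nat) : R :=
  if Ceq_dec (z k) (RtoC 0) then 0
  else rho theta (1 - Cmod (z k)) * Cmod (f (z k)).

(* The terms are nonnegative, so a finite sum means a convergent series. *)
Definition weighted_sum_finite (theta : R -> R) (f : C -> C) (z : nat -> C) : Prop :=
  ex_series (weighted_term theta f z).

Definition thin (theta : R -> R) (z : nat -> C) : Prop :=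
  exists f : C -> C,
    H_infty f /\ not_identically_zero f /\ weighted_sum_finite theta f z.

Definition Lambda (theta : R -> R) (z : nat -> C) : Prop :=
  disk_sequence z /\ separated z /\ thin theta z.

(* For [g] continuous on (0,1): the integral of [g] over (0,eps), improper at 0,
   is +infinity for all small eps in (0,1). *)
Definition integral_diverges_at_0 (g : R -> R) : Prop :=
  exists eps0 : R, 0 < eps0 < 1 /\
    forall eps : R, 0 < eps < eps0 ->
      filterlim (fun delta : R => RInt g delta eps)
        (at_right 0) (Rbar_locally p_infty).

(* Main.v *)
Require Import Defs.
From Stdlib Require Import Reals ZArith Lra Lia Classical.
From Coquelicot Require Import Coquelicot.
Open Scope R_scope.

(** On the circles [|z| = 1 - 2^-n] put [2^n] equally spaced points for [n] in a set [A] of levels,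
    and one point for the other [n]; this sequence is separated.  If [f = sum a_k z^k] is bounded,
    then [a_k -> 0] by Bessel's inequality, and averaging [f] over the [N = 2^n] points of a ring
    against the [m]-th character gives [a_m r^m + sum_(l>=1) a_(m+lN) r^(m+lN)] with [r^N <= 1/2],
    which tends to [a_m].  So if [a_m <> 0], the mean of [|f|] over a ring is bounded below for large [n],
    and the [rho_1]-weighted sum of [|f|] diverges as soon as [sum_(n in A) 2^n rho_1(2^-n)] does.
    Since [rho_2 / rho_1 -> 0], [A] can be chosen so that this last sum diverges while
    [sum_(n in A) 2^n rho_2(2^-n)] converges.

    The Taylor expansion is obtained from Goursat's theorem in logarithmic coordinates: the [m]-th
    Fourier coefficient of [f] on the circle of radius [r] is a constant times [r^m]. *)

(** The number [2^n] of points on a ring balances two demands: their spacing must stay comparable to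
    the distance [2^-n] to the unit circle, so that separation holds, and [(1 - 2^-n)^(2^n) <= 1/2]
    must damp the aliased Taylor coefficients geometrically.

    The bound [rho_1(t) <= C t] acts twice. It bounds the terms [2^n rho_1(2^-n)], so the greedy
    choice of levels never overshoots by more than a constant. It also makes the lone points on the
    other levels harmless, since their [rho_2]-weights are [O(2^-n)]; these points are there because
    the enumeration passes through every level. Monotonicity of [rho_1] turns the divergent integral
    into a divergent dyadic sum.

    Holomorphy is only pointwise differentiability, so Goursat's theorem is proved by bisection,
    without continuity of the derivative. Logarithmic coordinates turn circles into vertical
    segments, so rectangles suffice; the price is that the origin is excluded and has to be
    recovered by continuity. *)

(** * Complex-valued functions and their integrals *)

(** The quotient-free form also covers [h = 0], so compositions need no case distinction, and it is
    literally the remainder estimate that Goursat's argument integrates. *)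
Definition is_Cderive (f : C -> C) (z l : C) : Prop :=
  forall eps : R, 0 < eps -> exists del : R, 0 < del /\
    forall h : C, Cmod h < del ->
      Cmod (f (z + h) - f z - l * h)%C <= eps * Cmod h.

Definition Ccontinuous (f : C -> C) (z : C) : Prop :=
  forall eps : R, 0 < eps -> exists del : R, 0 < del /\
    forall h : C, Cmod h < del -> Cmod (f (z + h) - f z)%C < eps.

Definition path_continuous (g : R -> C) (x : R) : Prop :=
  forall eps : R, 0 < eps -> exists del : R, 0 < del /\
    forall y : R, Rabs (y - x) < del -> Cmod (g y - g x)%C < eps.

Definition CInt (g : R -> C) (a b : R) : C :=
  (RInt (fun t => Re (g t)) a b, RInt (fun t => Im (g t)) a b).

Lemma is_derive_Cderive (f : C -> C) (z l : C) :
  is_derive (K := C_AbsRing) (V := C_NormedModule) f z l -> is_Cderive f z l.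
Proof.
  intros [_ H] eps He.
  destruct (H z (fun P HP => HP) (mkposreal eps He)) as [d Hd].
  exists d. split; [apply cond_pos|]. intros h Hh.
  assert (Hb : ball (M := AbsRing_UniformSpace C_AbsRing) z d (z + h)%C).
  { change (Cmod (z + h - z)%C < d). replace (z + h - z)%C with h by ring. exact Hh. }
  specialize (Hd (z + h)%C Hb).
  change (Cmod (f (z + h) - f z - ((z + h) - z) * l)%C <= eps * Cmod ((z + h) - z)%C) in Hd.
  replace (z + h - z)%C with h in Hd by ring.
  rewrite (Cmult_comm l h). exact Hd.
Qed.

Lemma is_Cderive_continuous (f : C -> C) (z l : C) :
  is_Cderive f z l -> Ccontinuous f z.
Proof.
  intros H eps He.
  destruct (H 1 Rlt_0_1) as [d [Hd Hf]].
  pose proof (Cmod_ge_0 l) as Hl.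
  exists (Rmin d (eps / (2 + Cmod l))). split.
  - apply Rmin_pos; trivial. apply Rdiv_lt_0_compat; lra.
  - intros h Hh.
    assert (Hh1 := Rlt_le_trans _ _ _ Hh (Rmin_l _ _)).
    assert (Hh2 := Rlt_le_trans _ _ _ Hh (Rmin_r _ _)).
    replace (f (z + h) - f z)%C with ((f (z + h) - f z - l * h) + l * h)%C by ring.
    eapply Rle_lt_trans; [apply Cmod_triangle|]. rewrite Cmod_mult.
    specialize (Hf h Hh1). pose proof (Cmod_ge_0 h).
    apply Rle_lt_trans with ((1 + Cmod l) * Cmod h); [lra|].
    apply Rle_lt_trans with ((1 + Cmod l) * (eps / (2 + Cmod l))).
    { apply Rmult_le_compat_l; lra. }
    apply Rmult_lt_reg_r with (2 + Cmod l); [lra|].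
    replace ((1 + Cmod l) * (eps / (2 + Cmod l)) * (2 + Cmod l)) with ((1 + Cmod l) * eps) by (field; lra).
    nra.
Qed.

Lemma path_continuous_comp (f : C -> C) (g : R -> C) (x : R) :
  Ccontinuous f (g x) -> path_continuous g x -> path_continuous (fun t => f (g t)) x.
Proof.
  intros Hf Hg eps He.
  destruct (Hf eps He) as [d [Hd H1]].
  destruct (Hg d Hd) as [e [Hpe H2]].
  exists e. split; trivial. intros y Hy.
  specialize (H1 _ (H2 y Hy)).
  replace (g x + (g y - g x))%C with (g y) in H1 by ring. exact H1.
Qed.

Lemma im_le_Cmod (c : C) : Rabs (Im c) <= Cmod c.
Proof.
  eapply Rle_trans; [apply Rmax_r|apply (Rmax_Cmod c)].
Qed.

Lemma continuous_R_eps (u : R -> R) (x : R) :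
  continuous u x <->
  forall eps : R, 0 < eps -> exists del : R, 0 < del /\
    forall y : R, Rabs (y - x) < del -> Rabs (u y - u x) < eps.
Proof.
  split.
  - intros H eps He.
    assert (Hl : locally (u x) (fun v => Rabs (v - u x) < eps)).
    { exists (mkposreal eps He). intros v Hv. exact Hv. }
    destruct (H _ Hl) as [d Hd]. exists d. split; [apply cond_pos|].
    intros y Hy. exact (Hd y Hy).
  - intros H P [e HP].
    destruct (H e (cond_pos e)) as [d [Hd Hu]].
    exists (mkposreal d Hd). intros y Hy. apply HP. exact (Hu y Hy).
Qed.

Lemma path_continuous_components (g : R -> C) (x : R) :
  path_continuous g x <->
  continuous (fun t => Re (g t)) x /\ continuous (fun t => Im (g t)) x.
Proof.
  rewrite !continuous_R_eps. split.
  - intros H. split; intros eps He; destruct (H eps He) as [d [Hd Hg]];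
      exists d; split; trivial; intros y Hy; eapply Rle_lt_trans; [ | apply (Hg y Hy)| | apply (Hg y Hy)].
    + apply (re_le_Cmod (g y - g x)%C).
    + apply (im_le_Cmod (g y - g x)%C).
  - intros [H1 H2] eps He.
    destruct (H1 (eps / 2) ltac:(lra)) as [d1 [Hd1 K1]].
    destruct (H2 (eps / 2) ltac:(lra)) as [d2 [Hd2 K2]].
    exists (Rmin d1 d2). split; [apply Rmin_pos; trivial|].
    intros y Hy.
    specialize (K1 y (Rlt_le_trans _ _ _ Hy (Rmin_l _ _))).
    specialize (K2 y (Rlt_le_trans _ _ _ Hy (Rmin_r _ _))).
    set (w := (g y - g x)%C).
    assert (E : Cmod w ^ 2 = Re w ^ 2 + Im w ^ 2) by apply Cmod2_alt.
    change (Re (g y) - Re (g x)) with (Re w) in K1.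
    change (Im (g y) - Im (g x)) with (Im w) in K2.
    rewrite <- (pow2_abs (Re w)), <- (pow2_abs (Im w)) in E.
    pose proof (Cmod_ge_0 w). pose proof (Rabs_pos (Re w)). pose proof (Rabs_pos (Im w)).
    nra.
Qed.

Lemma path_continuous_plus (f g : R -> C) (x : R) :
  path_continuous f x -> path_continuous g x -> path_continuous (fun t => f t + g t)%C x.
Proof.
  rewrite !path_continuous_components. intros [H1 H2] [H3 H4]. split.
  - apply (continuous_plus (V := R_NormedModule) (fun t => Re (f t)) (fun t => Re (g t))); trivial.
  - apply (continuous_plus (V := R_NormedModule) (fun t => Im (f t)) (fun t => Im (g t))); trivial.
Qed.

Lemma path_continuous_mult (f g : R -> C) (x : R) :
  path_continuous f x -> path_continuous g x -> path_continuous (fun t => f t * g t)%C x.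
Proof.
  rewrite !path_continuous_components. intros [H1 H2] [H3 H4]. split.
  - apply (continuous_minus (V := R_NormedModule) (fun t => Re (f t) * Re (g t)) (fun t => Im (f t) * Im (g t)));
      apply (continuous_mult (K := R_AbsRing)); trivial.
  - apply (continuous_plus (V := R_NormedModule) (fun t => Re (f t) * Im (g t)) (fun t => Im (f t) * Re (g t)));
      apply (continuous_mult (K := R_AbsRing)); trivial.
Qed.

Lemma path_continuous_const (c : C) (x : R) : path_continuous (fun _ => c) x.
Proof.
  apply path_continuous_components. split; apply continuous_const.
Qed.

Lemma path_continuous_conj (f : R -> C) (x : R) :
  path_continuous f x -> path_continuous (fun t => Cconj (f t)) x.
Proof.
  rewrite !path_continuous_components. intros [H1 H2]. split; trivial.
  apply (continuous_opp (V := R_NormedModule) (fun t => Im (f t))). trivial.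
Qed.

Lemma path_continuous_ext (f g : R -> C) (x : R) :
  (forall t, f t = g t) -> path_continuous f x -> path_continuous g x.
Proof.
  intros E H eps He. destruct (H eps He) as [d [Hd K]].
  exists d. split; trivial. intros y Hy. rewrite <- !E. auto.
Qed.

Lemma path_continuous_minus (f g : R -> C) (x : R) :
  path_continuous f x -> path_continuous g x -> path_continuous (fun t => f t - g t)%C x.
Proof.
  intros Hf Hg.
  apply path_continuous_ext with (fun t => f t + (RtoC (-1)) * g t)%C.
  { intros t. apply injective_projections; simpl; ring. }
  apply path_continuous_plus; trivial.
  apply path_continuous_mult; trivial. apply path_continuous_const.
Qed.

Definition cont_on (g : R -> C) (a b : R) : Prop :=
  forall t : R, a <= t <= b -> path_continuous g t.

Lemma ex_RInt_Re (g : R -> C) (a b : R) :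
  a <= b -> cont_on g a b -> ex_RInt (fun t => Re (g t)) a b.
Proof.
  intros Hab H. apply (ex_RInt_continuous (V := R_CompleteNormedModule)). intros t Ht.
  rewrite Rmin_left, Rmax_right in Ht by trivial.
  apply (proj1 (path_continuous_components g t)); auto.
Qed.

Lemma ex_RInt_Im (g : R -> C) (a b : R) :
  a <= b -> cont_on g a b -> ex_RInt (fun t => Im (g t)) a b.
Proof.
  intros Hab H. apply (ex_RInt_continuous (V := R_CompleteNormedModule)). intros t Ht.
  rewrite Rmin_left, Rmax_right in Ht by trivial.
  apply (proj1 (path_continuous_components g t)); auto.
Qed.

Lemma CInt_ext (f g : R -> C) (a b : R) :
  a <= b -> (forall t, a <= t <= b -> f t = g t) -> CInt f a b = CInt g a b.
Proof.
  intros Hab H. unfold CInt. f_equal; apply RInt_ext; intros t Ht;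
    rewrite Rmin_left, Rmax_right in Ht by trivial; rewrite H by lra; reflexivity.
Qed.

Lemma CInt_plus (f g : R -> C) (a b : R) :
  a <= b -> cont_on f a b -> cont_on g a b ->
  CInt (fun t => f t + g t)%C a b = (CInt f a b + CInt g a b)%C.
Proof.
  intros Hab Hf Hg. unfold CInt, Cplus; simpl. f_equal.
  - apply (RInt_plus (V := R_CompleteNormedModule)); apply ex_RInt_Re; trivial.
  - apply (RInt_plus (V := R_CompleteNormedModule)); apply ex_RInt_Im; trivial.
Qed.

Lemma RInt_Rmult_l (k : R) (u : R -> R) (a b : R) :
  ex_RInt u a b -> RInt (fun t => k * u t) a b = k * RInt u a b.
Proof. exact (RInt_scal (V := R_CompleteNormedModule) u a b k). Qed.

Lemma CInt_scal (c : C) (g : R -> C) (a b : R) :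
  a <= b -> cont_on g a b -> CInt (fun t => c * g t)%C a b = (c * CInt g a b)%C.
Proof.
  intros Hab Hg. unfold CInt, Cmult; simpl.
  assert (H1 := ex_RInt_Re g a b Hab Hg). assert (H2 := ex_RInt_Im g a b Hab Hg).
  unfold Re, Im in *.
  f_equal.
  - rewrite (RInt_minus (V := R_CompleteNormedModule) (fun t => fst c * fst (g t)) (fun t => snd c * snd (g t))).
    + rewrite (RInt_Rmult_l (fst c) (fun t => fst (g t))) by trivial.
      rewrite (RInt_Rmult_l (snd c) (fun t => snd (g t))) by trivial.
      reflexivity.
    + apply (ex_RInt_scal (V := R_CompleteNormedModule) (fun t => fst (g t))); trivial.
    + apply (ex_RInt_scal (V := R_CompleteNormedModule) (fun t => snd (g t))); trivial.
  - rewrite (RInt_plus (V := R_CompleteNormedModule) (fun t => fst c * snd (g t)) (fun t => snd c * fst (g t))).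
    + rewrite (RInt_Rmult_l (snd c) (fun t => fst (g t))) by trivial.
      rewrite (RInt_Rmult_l (fst c) (fun t => snd (g t))) by trivial.
      reflexivity.
    + apply (ex_RInt_scal (V := R_CompleteNormedModule) (fun t => snd (g t))); trivial.
    + apply (ex_RInt_scal (V := R_CompleteNormedModule) (fun t => fst (g t))); trivial.
Qed.

Lemma cont_on_scal (c : C) (g : R -> C) (a b : R) :
  cont_on g a b -> cont_on (fun t => c * g t)%C a b.
Proof.
  intros H t Ht. apply path_continuous_mult; auto. apply path_continuous_const.
Qed.

Lemma CInt_minus (f g : R -> C) (a b : R) :
  a <= b -> cont_on f a b -> cont_on g a b ->
  CInt (fun t => f t - g t)%C a b = (CInt f a b - CInt g a b)%C.
Proof.
  intros Hab Hf Hg.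
  transitivity (CInt (fun t => f t + (RtoC (-1)) * g t)%C a b).
  { apply CInt_ext; trivial. intros. apply injective_projections; simpl; ring. }
  rewrite CInt_plus, CInt_scal; trivial.
  - apply injective_projections; simpl; ring.
  - apply cont_on_scal; trivial.
Qed.

Lemma CInt_Chasles (g : R -> C) (a b c : R) :
  a <= b -> b <= c -> cont_on g a c -> (CInt g a b + CInt g b c)%C = CInt g a c.
Proof.
  intros Hab Hbc H.
  assert (H1 : cont_on g a b) by (intros t Ht; apply H; lra).
  assert (H2 : cont_on g b c) by (intros t Ht; apply H; lra).
  unfold CInt, Cplus; simpl. f_equal.
  - apply (RInt_Chasles (V := R_CompleteNormedModule)); apply ex_RInt_Re; trivial.
  - apply (RInt_Chasles (V := R_CompleteNormedModule)); apply ex_RInt_Im; trivial.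
Qed.

Lemma CInt_const (c : C) (a b : R) : CInt (fun _ => c) a b = (c * RtoC (b - a))%C.
Proof.
  unfold CInt. rewrite !RInt_const.
  unfold scal; simpl; unfold mult; simpl. apply injective_projections; simpl; unfold Re, Im; ring.
Qed.

Lemma CInt_id (a b : R) : CInt RtoC a b = RtoC ((b ^ 2 - a ^ 2) / 2).
Proof.
  unfold CInt, RtoC at 3; simpl. f_equal.
  - apply is_RInt_unique.
    replace ((b * (b * 1) - a * (a * 1)) / 2) with (minus (b ^ 2 / 2) (a ^ 2 / 2))
      by (unfold minus, plus, opp; simpl; field).
    apply (is_RInt_derive (V := R_CompleteNormedModule) (fun t => t ^ 2 / 2)).
    + intros t _. auto_derive; trivial. change (Re (RtoC t)) with t. field.
    + intros t _. apply continuous_id.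
  - transitivity (RInt (V := R_CompleteNormedModule) (fun _ => 0) a b).
    + apply RInt_ext. intros; reflexivity.
    + rewrite RInt_const. unfold scal; simpl; unfold mult; simpl; ring.
Qed.

Lemma CInt_bound (g : R -> C) (a b B : R) :
  a <= b -> cont_on g a b -> (forall t, a <= t <= b -> Cmod (g t) <= B) ->
  Cmod (CInt g a b) <= B * (b - a).
Proof.
  intros Hab Hg HB.
  set (w := CInt g a b).
  destruct (Ceq_dec w (RtoC 0)) as [E|E].
  { rewrite E, Cmod_0. apply Rmult_le_pos; [|lra].
    eapply Rle_trans; [apply Cmod_ge_0|apply (HB a); lra]. }
  assert (Hw : 0 < Cmod w) by (apply Cmod_gt_0; trivial).
  (* pairing with [conj w] reduces the bound to that of a real integral *)
  assert (H : CInt (fun t => Cconj w * g t)%C a b = RtoC (Cmod w ^ 2)).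
  { rewrite CInt_scal by trivial. fold w. rewrite Cmult_comm. symmetry. apply Cmod2_conj. }
  assert (H1 : RInt (fun t => Re (Cconj w * g t)%C) a b = Cmod w ^ 2) by exact (f_equal Re H).
  assert (H2 : RInt (fun t => Re (Cconj w * g t)%C) a b <= Cmod w * B * (b - a)).
  { replace (Cmod w * B * (b - a)) with (RInt (V := R_CompleteNormedModule) (fun _ => Cmod w * B) a b)
      by (rewrite RInt_const; unfold scal; simpl; unfold mult; simpl; ring).
    apply RInt_le; trivial.
    - apply ex_RInt_Re; trivial. apply cont_on_scal; trivial.
    - apply ex_RInt_const.
    - intros t Ht. eapply Rle_trans; [apply Rle_abs|].
      eapply Rle_trans; [apply re_le_Cmod|]. rewrite Cmod_mult, Cmod_conj.
      apply Rmult_le_compat_l; [lra|]. apply HB; lra. }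
  nra.
Qed.

(** * Goursat's theorem for rectangles *)

(** The contour integral along the boundary of [[a,b] x [c,d]], run counterclockwise. *)
Definition rect_int (G : C -> C) (a b c d : R) : C :=
  (CInt (fun x => G (x, c)) a b - CInt (fun x => G (x, d)) a b
   + Ci * (CInt (fun y => G (b, y)) c d - CInt (fun y => G (a, y)) c d))%C.

Lemma path_continuous_horizontal (G : C -> C) (x y : R) :
  Ccontinuous G (x, y) -> path_continuous (fun t => G (t, y)) x.
Proof.
  intros H. apply (path_continuous_comp G (fun t => (t, y))); trivial.
  apply path_continuous_components. split; [apply continuous_id|apply continuous_const].
Qed.

Lemma path_continuous_vertical (G : C -> C) (x y : R) :
  Ccontinuous G (x, y) -> path_continuous (fun t => G (x, t)) y.
Proof.
  intros H. apply (path_continuous_comp G (fun t => (x, t))); trivial.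
  apply path_continuous_components. split; [apply continuous_const|apply continuous_id].
Qed.

Definition rect_continuous (G : C -> C) (a b c d : R) : Prop :=
  forall x y, a <= x <= b -> c <= y <= d -> Ccontinuous G (x, y).

(** Each inner side is run twice in opposite directions, so only the outer sides have to be cut. *)
Lemma rect_int_split (G : C -> C) (a m b c n d : R) :
  a <= m <= b -> c <= n <= d -> rect_continuous G a b c d ->
  rect_int G a b c d =
  (rect_int G a m c n + rect_int G m b c n + rect_int G a m n d + rect_int G m b n d)%C.
Proof.
  intros Hm Hn HG. unfold rect_int.
  rewrite <- (CInt_Chasles (fun x => G (x, c)) a m b), <- (CInt_Chasles (fun x => G (x, d)) a m b),
    <- (CInt_Chasles (fun y => G (b, y)) c n d), <- (CInt_Chasles (fun y => G (a, y)) c n d);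
    try lra; try (intros t Ht; (apply path_continuous_horizontal || apply path_continuous_vertical);
    apply HG; lra).
  ring.
Qed.

Lemma rect_int_minus (F G : C -> C) (a b c d : R) :
  a <= b -> c <= d -> rect_continuous F a b c d -> rect_continuous G a b c d ->
  rect_int (fun z => F z - G z)%C a b c d = (rect_int F a b c d - rect_int G a b c d)%C.
Proof.
  intros Hab Hcd HF HG. unfold rect_int.
  rewrite !CInt_minus; trivial; [ring|..];
    intros t Ht; (apply path_continuous_horizontal || apply path_continuous_vertical);
    (apply HF || apply HG); lra.
Qed.

Lemma is_Cderive_affine (u v z : C) : is_Cderive (fun w => u + v * w)%C z v.
Proof.
  intros eps He. exists 1. split; [lra|]. intros h _.
  replace (u + v * (z + h) - (u + v * z) - v * h)%C with (RtoC 0) by ring.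
  rewrite Cmod_0. apply Rmult_le_pos; [lra|apply Cmod_ge_0].
Qed.

(** The base case of Goursat's theorem, computed directly: each side is an affine function of a real
    parameter with an explicit quadratic integral. *)
Lemma rect_int_affine (u v : C) (a b c d : R) :
  a <= b -> c <= d -> rect_int (fun z => u + v * z)%C a b c d = RtoC 0.
Proof.
  intros Hab Hcd. unfold rect_int.
  assert (Hid : forall a b, cont_on RtoC a b).
  { intros p q t _. apply path_continuous_components. split; [apply continuous_id|apply continuous_const]. }
  assert (HI : forall (p q : C) (s t : R), s <= t ->
    CInt (fun x => p + q * RtoC x)%C s t = (p * RtoC (t - s) + q * RtoC ((t ^ 2 - s ^ 2) / 2))%C).
  { intros p q s t Hst. rewrite CInt_plus; trivial.
    - rewrite CInt_const, CInt_scal, CInt_id; trivial. 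
    - intros x _. apply path_continuous_const.
    - apply cont_on_scal. trivial. }
  rewrite (CInt_ext (fun x => u + v * (x, c))%C (fun x => (u + v * (0, c)) + v * RtoC x)%C a b)
    by (trivial; intros; apply injective_projections; simpl; ring).
  rewrite (CInt_ext (fun x => u + v * (x, d))%C (fun x => (u + v * (0, d)) + v * RtoC x)%C a b)
    by (trivial; intros; apply injective_projections; simpl; ring).
  rewrite (CInt_ext (fun y => u + v * (b, y))%C (fun x => (u + v * (b, 0)) + v * Ci * RtoC x)%C c d)
    by (trivial; intros; apply injective_projections; simpl; ring).
  rewrite (CInt_ext (fun y => u + v * (a, y))%C (fun x => (u + v * (a, 0)) + v * Ci * RtoC x)%C c d)
    by (trivial; intros; apply injective_projections; simpl; ring).
  rewrite !HI by trivial.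
  apply injective_projections; simpl; field.
Qed.

Lemma rect_int_bound (G : C -> C) (a b c d B : R) :
  a <= b -> c <= d -> rect_continuous G a b c d ->
  (forall x y, a <= x <= b -> c <= y <= d -> Cmod (G (x, y)) <= B) ->
  Cmod (rect_int G a b c d) <= 2 * B * ((b - a) + (d - c)).
Proof.
  intros Hab Hcd HG HB. unfold rect_int.
  assert (H1 : Cmod (CInt (fun x => G (x, c)) a b) <= B * (b - a)).
  { apply CInt_bound; trivial; intros t Ht; [apply path_continuous_horizontal, HG|apply HB]; lra. }
  assert (H2 : Cmod (CInt (fun x => G (x, d)) a b) <= B * (b - a)).
  { apply CInt_bound; trivial; intros t Ht; [apply path_continuous_horizontal, HG|apply HB]; lra. }
  assert (H3 : Cmod (CInt (fun y => G (b, y)) c d) <= B * (d - c)).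
  { apply CInt_bound; trivial; intros t Ht; [apply path_continuous_vertical, HG|apply HB]; lra. }
  assert (H4 : Cmod (CInt (fun y => G (a, y)) c d) <= B * (d - c)).
  { apply CInt_bound; trivial; intros t Ht; [apply path_continuous_vertical, HG|apply HB]; lra. }
  eapply Rle_trans; [apply Cmod_triangle|]. rewrite Cmod_mult, Cmod_Ci, Rmult_1_l.
  assert (Hm : forall p q, Cmod (p - q)%C <= Cmod p + Cmod q).
  { intros p q. unfold Cminus. eapply Rle_trans; [apply Cmod_triangle|]. rewrite Cmod_opp. lra. }
  pose proof (Hm (CInt (fun x => G (x, c)) a b) (CInt (fun x => G (x, d)) a b)).
  pose proof (Hm (CInt (fun y => G (b, y)) c d) (CInt (fun y => G (a, y)) c d)).
  lra.
Qed.

(** The left ends increase and lie below every right end, so their limit belongs to all the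
    intervals. *)
Lemma nested_intervals (x w : nat -> R) :
  (forall n, x n <= x (S n)) -> (forall n, x (S n) + w (S n) <= x n + w n) ->
  (forall n, 0 <= w n) -> exists l : R, forall n, x n <= l <= x n + w n.
Proof.
  intros H1 H2 Hw.
  assert (I1 : forall n k, x n <= x (n + k)%nat).
  { intros n k. induction k as [|k IH]; [rewrite Nat.add_0_r; lra|].
    rewrite Nat.add_succ_r. specialize (H1 (n + k)%nat). lra. }
  assert (I2 : forall n k, x (n + k)%nat + w (n + k)%nat <= x n + w n).
  { intros n k. induction k as [|k IH]; [rewrite Nat.add_0_r; lra|].
    rewrite Nat.add_succ_r. specialize (H2 (n + k)%nat). lra. }
  assert (I3 : forall n m, x n <= x m + w m).
  { intros n m. specialize (I1 n m). specialize (I2 m n). specialize (Hw (m + n)%nat).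
    rewrite (Nat.add_comm n m) in I1. lra. }
  destruct (ex_finite_lim_seq_incr x (x 0%nat + w 0%nat) H1 (fun n => I3 n 0%nat)) as [l Hl].
  exists l. intros n. split.
  - apply (is_lim_seq_incr_compare x l Hl H1).
  - apply (is_lim_seq_le x (fun _ => x n + w n) l (x n + w n) (fun m => I3 m n) Hl).
    apply is_lim_seq_const.
Qed.

Lemma Rdiv_pow2_S (L : R) (n : nat) : L / 2 ^ n = L / 2 ^ S n + L / 2 ^ S n.
Proof. simpl. field. apply pow_nonzero; lra. Qed.

Section Bisection.

Variables (G : C -> C) (a c L H eta : R).

Definition subrect_int (n : nat) (p : R * R) : R :=
  Cmod (rect_int G (fst p) (fst p + L / 2 ^ n) (snd p) (snd p + H / 2 ^ n)).

(** At stage [n] all rectangles have sides [L / 2^n] and [H / 2^n], so a lower left corner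
    determines one. The first quarter with a large enough integral is taken; the fourth is the
    default and is not tested. *)
Definition next_corner (n : nat) (p : R * R) : R * R :=
  let p1 := (fst p + L / 2 ^ S n, snd p) in
  let p2 := (fst p, snd p + H / 2 ^ S n) in
  let p3 := (fst p + L / 2 ^ S n, snd p + H / 2 ^ S n) in
  if Rle_dec (eta / 4 ^ S n) (subrect_int (S n) p) then p
  else if Rle_dec (eta / 4 ^ S n) (subrect_int (S n) p1) then p1
  else if Rle_dec (eta / 4 ^ S n) (subrect_int (S n) p2) then p2 else p3.

Fixpoint corner (n : nat) : R * R :=
  match n with O => (a, c) | S m => next_corner m (corner m) end.

Lemma next_corner_step (n : nat) (p : R * R) :
  (fst (next_corner n p) = fst p \/ fst (next_corner n p) = fst p + L / 2 ^ S n) /\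
  (snd (next_corner n p) = snd p \/ snd (next_corner n p) = snd p + H / 2 ^ S n).
Proof.
  unfold next_corner.
  repeat (destruct Rle_dec; [simpl; tauto|]). simpl; tauto.
Qed.

Hypothesis L_ge0 : 0 <= L.
Hypothesis H_ge0 : 0 <= H.

Lemma side_ge0 (K : R) (n : nat) : 0 <= K -> 0 <= K / 2 ^ n.
Proof.
  intros HK. apply Rmult_le_pos; trivial. left. apply Rinv_0_lt_compat, pow_lt; lra.
Qed.

Lemma corner_step (n : nat) :
  (fst (corner n) <= fst (corner (S n)) /\
   fst (corner (S n)) + L / 2 ^ S n <= fst (corner n) + L / 2 ^ n) /\
  (snd (corner n) <= snd (corner (S n)) /\
   snd (corner (S n)) + H / 2 ^ S n <= snd (corner n) + H / 2 ^ n).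
Proof.
  change (corner (S n)) with (next_corner n (corner n)).
  rewrite (Rdiv_pow2_S L n), (Rdiv_pow2_S H n).
  pose proof (side_ge0 L (S n) L_ge0). pose proof (side_ge0 H (S n) H_ge0).
  destruct (next_corner_step n (corner n)) as [[-> | ->] [-> | ->]]; lra.
Qed.

Lemma corner_range (n : nat) :
  a <= fst (corner n) /\ fst (corner n) + L / 2 ^ n <= a + L /\
  c <= snd (corner n) /\ snd (corner n) + H / 2 ^ n <= c + H.
Proof.
  induction n as [|n IH]; [simpl; lra|].
  pose proof (corner_step n). lra.
Qed.

Hypothesis G_cont : rect_continuous G a (a + L) c (c + H).
Hypothesis eta_le : eta <= Cmod (rect_int G a (a + L) c (c + H)).

(** If the first three quarters all stay below a quarter of the previous bound, the triangle
    inequality forces the fourth to reach it, which justifies the untested default. *)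
Lemma corner_large (n : nat) : eta / 4 ^ n <= subrect_int n (corner n).
Proof.
  induction n as [|n IH].
  - unfold subrect_int; simpl. rewrite !Rdiv_1_r. exact eta_le.
  - change (corner (S n)) with (next_corner n (corner n)).
    pose proof (corner_range n) as Hr.
    pose proof (side_ge0 L (S n) L_ge0) as HL. pose proof (side_ge0 H (S n) H_ge0) as HH.
    set (p := corner n) in *.
    unfold next_corner.
    destruct Rle_dec as [?|N1]; trivial.
    destruct Rle_dec as [?|N2]; trivial.
    destruct Rle_dec as [?|N3]; trivial.
    apply Rnot_le_lt in N1, N2, N3.
    unfold subrect_int in *. cbn [fst snd] in *.
    rewrite (Rdiv_pow2_S L n), (Rdiv_pow2_S H n), <- !Rplus_assoc in *.
    rewrite (rect_int_split G (fst p) (fst p + L / 2 ^ S n) _ (snd p) (snd p + H / 2 ^ S n) _) in IH.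
    + set (I1 := rect_int G (fst p) (fst p + L / 2 ^ S n) (snd p) (snd p + H / 2 ^ S n)) in *.
      set (I2 := rect_int G (fst p + L / 2 ^ S n) (fst p + L / 2 ^ S n + L / 2 ^ S n) (snd p) (snd p + H / 2 ^ S n)) in *.
      set (I3 := rect_int G (fst p) (fst p + L / 2 ^ S n) (snd p + H / 2 ^ S n) (snd p + H / 2 ^ S n + H / 2 ^ S n)) in *.
      set (I4 := rect_int G (fst p + L / 2 ^ S n) (fst p + L / 2 ^ S n + L / 2 ^ S n) (snd p + H / 2 ^ S n) (snd p + H / 2 ^ S n + H / 2 ^ S n)) in *.
      pose proof (Cmod_triangle (I1 + I2 + I3)%C I4).
      pose proof (Cmod_triangle (I1 + I2)%C I3).
      pose proof (Cmod_triangle I1 I2).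
      assert (E : eta / 4 ^ n = 4 * (eta / 4 ^ S n)) by (simpl; field; apply pow_nonzero; lra).
      lra.
    + lra.
    + lra.
    + intros x y Hx Hy. apply G_cont; lra.
Qed.

End Bisection.

Lemma half_pow_lt (K e : R) : 0 < e -> exists n : nat, K / 2 ^ n < e.
Proof.
  intros He.
  assert (Hl : is_lim_seq (fun n => K * (/ 2) ^ n) (K * 0)).
  { apply is_lim_seq_mult'; [apply is_lim_seq_const|].
    apply is_lim_seq_geom. rewrite Rabs_pos_eq; lra. }
  rewrite Rmult_0_r in Hl.
  apply is_lim_seq_spec in Hl. destruct (Hl (mkposreal e He)) as [n Hn].
  exists n. specialize (Hn n (le_n n)). simpl in Hn. rewrite Rminus_0_r in Hn.
  apply Rle_lt_trans with (2 := Hn). unfold Rdiv. rewrite pow_inv. apply Rle_abs.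
Qed.

Lemma Cmod_pair_le (x y : R) : Cmod (x, y) <= Rabs x + Rabs y.
Proof.
  replace ((x, y) : C) with (RtoC x + Ci * RtoC y)%C by (apply injective_projections; simpl; ring).
  eapply Rle_trans; [apply Cmod_triangle|]. rewrite Cmod_mult, Cmod_Ci, !Cmod_R. lra.
Qed.

Theorem goursat (G : C -> C) (a b c d : R) :
  a <= b -> c <= d ->
  (forall x y, a <= x <= b -> c <= y <= d -> exists l, is_Cderive G (x, y) l) ->
  rect_int G a b c d = RtoC 0.
Proof.
  intros Hab Hcd HG.
  assert (Hcont : rect_continuous G a b c d).
  { intros x y Hx Hy. destruct (HG x y Hx Hy) as [l Hl]. apply (is_Cderive_continuous G _ l Hl). }
  set (L := b - a). set (H := d - c).
  assert (HL : 0 <= L) by (unfold L; lra). assert (HH : 0 <= H) by (unfold H; lra).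
  replace b with (a + L) in * by (unfold L; ring).
  replace d with (c + H) in * by (unfold H; ring).
  clearbody L H. clear b d Hab Hcd.
  apply Cmod_eq_0. set (eta := Cmod (rect_int G a (a + L) c (c + H))).
  assert (Heta : 0 <= eta) by apply Cmod_ge_0.
  set (p := corner G a c L H eta).
  destruct (nested_intervals (fun n => fst (p n)) (fun n => L / 2 ^ n)) as [x Hx];
    try (intros n; apply corner_step; trivial); [intros n; apply side_ge0; trivial|].
  destruct (nested_intervals (fun n => snd (p n)) (fun n => H / 2 ^ n)) as [y Hy];
    try (intros n; apply corner_step; trivial); [intros n; apply side_ge0; trivial|].
  simpl in Hx, Hy.
  destruct (HG x y) as [l Hl].
  { specialize (Hx O). simpl in Hx. lra. }
  { specialize (Hy O). simpl in Hy. lra. }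
  (* At stage [n] both the perimeter and the distance to the limit point are of order
     [(L + H) / 2^n]; their product carries the factor [4^-n] that also occurs in the lower bound,
     so it cancels. *)
  assert (Hsmall : forall eps, 0 < eps -> eta <= 2 * eps * (L + H) * (L + H)).
  { intros eps He.
    destruct (Hl eps He) as [del [Hdel Hd]].
    destruct (half_pow_lt (L + H) del Hdel) as [n Hn].
    pose proof (corner_large G a c L H eta HL HH Hcont (Rle_refl _) n) as Hlarge.
    pose proof (corner_range G a c L H eta HL HH n) as Hr.
    fold p in Hlarge, Hr. unfold subrect_int in Hlarge.
    specialize (Hx n). specialize (Hy n).
    pose proof (side_ge0 L n HL) as HLn. pose proof (side_ge0 H n HH) as HHn.
    assert (Es : (L + H) / 2 ^ n = L / 2 ^ n + H / 2 ^ n) by (unfold Rdiv; ring).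
    rewrite Es in Hn.
    set (u := fst (p n)) in *. set (v := snd (p n)) in *.
    set (Ln := L / 2 ^ n) in *. set (Hn' := H / 2 ^ n) in *.
    (* The first-order expansion of [G] at the limit point has zero contour integral, so only the
       remainder of size [eps] times the distance counts. *)
    set (A := fun z : C => ((G (x, y) - l * (x, y)) + l * z)%C).
    assert (HcontA : rect_continuous A u (u + Ln) v (v + Hn')).
    { intros s t _ _. apply (is_Cderive_continuous _ _ l). apply is_Cderive_affine. }
    assert (HcontG : rect_continuous G u (u + Ln) v (v + Hn')).
    { intros s t Hs Ht. apply Hcont; lra. }
    assert (HcontD : rect_continuous (fun z => G z - A z)%C u (u + Ln) v (v + Hn')).
    { intros s t Hs Ht.
      destruct (HG s t ltac:(lra) ltac:(lra)) as [l' Hl'].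
      apply (is_Cderive_continuous _ _ (l' - l)%C).
      intros e He'. destruct (Hl' e He') as [r [Hr0 Hr1]]. exists r. split; trivial.
      intros h Hh. unfold A. specialize (Hr1 h Hh).
      match goal with |- Cmod ?X <= _ => match type of Hr1 with Cmod ?Y <= _ =>
        replace X with Y by ring end end. exact Hr1. }
    assert (EI : rect_int (fun z => G z - A z)%C u (u + Ln) v (v + Hn') = rect_int G u (u + Ln) v (v + Hn')).
    { rewrite rect_int_minus; trivial; try lra. unfold A. rewrite rect_int_affine by lra. ring. }
    rewrite <- EI in Hlarge.
    assert (HB : Cmod (rect_int (fun z => G z - A z)%C u (u + Ln) v (v + Hn'))
                 <= 2 * (eps * (Ln + Hn')) * ((u + Ln - u) + (v + Hn' - v))).
    { apply rect_int_bound; trivial; try lra.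
      intros s t Hs Ht.
      assert (Hh : Cmod (s - x, t - y) <= Ln + Hn').
      { eapply Rle_trans; [apply Cmod_pair_le|]. apply Rplus_le_compat; apply Rabs_le; lra. }
      specialize (Hd _ (Rle_lt_trans _ _ _ Hh Hn)).
      set (h := (s - x, t - y) : C) in *.
      assert (Eh : ((x, y) + h)%C = (s, t)) by (apply injective_projections; simpl; ring).
      rewrite Eh in Hd. rewrite <- Eh at 2.
      match type of Hd with Cmod ?Y <= _ => replace (G (s, t) - A ((x, y) + h))%C with Y
        by (unfold A; ring) end.
      eapply Rle_trans; [apply Hd|]. apply Rmult_le_compat_l; lra. }
    assert (E1 : (u + Ln - u) + (v + Hn' - v) = (L + H) / 2 ^ n) by (rewrite Es; ring).
    rewrite E1, <- Es in HB.
    assert (E4 : 4 ^ n = 2 ^ n * 2 ^ n) by (rewrite <- Rpow_mult_distr; f_equal; lra).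
    assert (P2 : 0 < 2 ^ n) by (apply pow_lt; lra).
    assert (E5 : 2 * (eps * ((L + H) / 2 ^ n)) * ((L + H) / 2 ^ n)
      = 2 * eps * (L + H) * (L + H) / 4 ^ n).
    { rewrite E4. field. lra. }
    rewrite E5 in HB.
    apply Rmult_le_reg_r with (/ 4 ^ n); [apply Rinv_0_lt_compat, pow_lt; lra|].
    unfold Rdiv in *. lra. }
  destruct (Rle_lt_or_eq_dec 0 eta Heta) as [Hpos|Hz]; [|symmetry; exact Hz].
  exfalso. set (S := (L + H) * (L + H)). assert (HS : 0 <= S) by (apply Rmult_le_pos; lra).
  (* With this [eps] the bound becomes [eta / 2 * (S / (S + 1))], which is less than [eta]. *)
  specialize (Hsmall (eta / (4 * (S + 1))) ltac:(apply Rdiv_lt_0_compat; lra)).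
  assert (E : 2 * (eta / (4 * (S + 1))) * (L + H) * (L + H) = eta / 2 * (S / (S + 1))).
  { unfold S. field. fold S. lra. }
  rewrite E in Hsmall.
  assert (S / (S + 1) <= 1).
  { apply Rmult_le_reg_r with (S + 1); [lra|]. unfold Rdiv. rewrite Rmult_assoc, Rinv_l; lra. }
  nra.
Qed.

(** * The complex exponential *)

(** The [+ 1] lets a tolerance be divided by a modulus that may vanish. *)
Lemma div_succ_mult_le (e a : R) : 0 < e -> 0 <= a -> e / (a + 1) * a <= e.
Proof.
  intros He Ha. apply Rmult_le_reg_r with (a + 1); [lra|].
  replace (e / (a + 1) * a * (a + 1)) with (e * a) by (field; lra). nra.
Qed.

Lemma is_Cderive_comp (f g : C -> C) (z lf lg : C) :
  is_Cderive f (g z) lf -> is_Cderive g z lg -> is_Cderive (fun w => f (g w)) z (lf * lg)%C.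
Proof.
  intros Hf Hg eps He.
  pose proof (Cmod_ge_0 lf) as Plf. pose proof (Cmod_ge_0 lg) as Plg.
  set (e1 := eps / 2 / (Cmod lg + 1)). set (e2 := eps / 2 / (Cmod lf + 1)).
  assert (P1 : 0 < e1) by (apply Rdiv_lt_0_compat; lra).
  assert (P2 : 0 < e2) by (apply Rdiv_lt_0_compat; lra).
  destruct (Hf e1 P1) as [d1 [Pd1 H1]].
  destruct (Hg e2 P2) as [d2 [Pd2 H2]].
  destruct (Hg 1 Rlt_0_1) as [d3 [Pd3 H3]].
  destruct (is_Cderive_continuous g z lg Hg d1 Pd1) as [d4 [Pd4 H4]].
  exists (Rmin (Rmin d2 d3) d4). split; [repeat apply Rmin_pos; trivial|].
  intros h Hh.
  assert (K2 := Rlt_le_trans _ _ _ Hh (Rle_trans _ _ _ (Rmin_l _ _) (Rmin_l _ _))).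
  assert (K3 := Rlt_le_trans _ _ _ Hh (Rle_trans _ _ _ (Rmin_l _ _) (Rmin_r _ _))).
  assert (K4 := Rlt_le_trans _ _ _ Hh (Rmin_r _ _)).
  specialize (H2 h K2). specialize (H3 h K3). specialize (H4 h K4).
  set (k := (g (z + h) - g z)%C) in *.
  specialize (H1 k H4).
  replace (g z + k)%C with (g (z + h)%C) in H1 by (unfold k; ring).
  replace (f (g (z + h)) - f (g z) - lf * lg * h)%C
    with ((f (g (z + h)) - f (g z) - lf * k) + lf * (k - lg * h))%C by ring.
  assert (Hk : Cmod k <= (Cmod lg + 1) * Cmod h).
  { replace k with ((k - lg * h) + lg * h)%C by ring.
    eapply Rle_trans; [apply Cmod_triangle|]. rewrite Cmod_mult. lra. }
  eapply Rle_trans; [apply Cmod_triangle|]. rewrite (Cmod_mult lf).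
  pose proof (Cmod_ge_0 h).
  assert (A1 : e1 * Cmod k <= eps / 2 * Cmod h).
  { apply Rle_trans with (e1 * ((Cmod lg + 1) * Cmod h)); [apply Rmult_le_compat_l; lra|].
    right. unfold e1. field. lra. }
  assert (A2 : Cmod lf * Cmod (k - lg * h)%C <= eps / 2 * Cmod h).
  { apply Rle_trans with (Cmod lf * (e2 * Cmod h)); [apply Rmult_le_compat_l; lra|].
    rewrite <- Rmult_assoc. apply Rmult_le_compat_r; trivial. rewrite Rmult_comm.
    apply div_succ_mult_le; lra. }
  lra.
Qed.

Lemma is_Cderive_mult (f g : C -> C) (z lf lg : C) :
  is_Cderive f z lf -> is_Cderive g z lg ->
  is_Cderive (fun w => f w * g w)%C z (lf * g z + f z * lg)%C.
Proof.
  intros Hf Hg eps He.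
  pose proof (Cmod_ge_0 lf). pose proof (Cmod_ge_0 (f z)). pose proof (Cmod_ge_0 (g z)).
  set (e1 := eps / 3 / (Cmod (g z) + 1)). set (e2 := eps / 3 / (Cmod (f z) + 1)).
  set (e3 := Rmin 1 (eps / 3 / (Cmod lf + 1))).
  assert (P1 : 0 < e1) by (apply Rdiv_lt_0_compat; lra).
  assert (P2 : 0 < e2) by (apply Rdiv_lt_0_compat; lra).
  assert (P3 : 0 < e3) by (apply Rmin_pos; [|apply Rdiv_lt_0_compat]; lra).
  destruct (Hf e1 P1) as [d1 [Pd1 D1]].
  destruct (Hg e2 P2) as [d2 [Pd2 D2]].
  destruct (is_Cderive_continuous g z lg Hg e3 P3) as [d3 [Pd3 D3]].
  exists (Rmin (Rmin d1 d2) d3). split; [repeat apply Rmin_pos; trivial|].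
  intros h Hh.
  specialize (D1 h (Rlt_le_trans _ _ _ Hh (Rle_trans _ _ _ (Rmin_l _ _) (Rmin_l _ _)))).
  specialize (D2 h (Rlt_le_trans _ _ _ Hh (Rle_trans _ _ _ (Rmin_l _ _) (Rmin_r _ _)))).
  specialize (D3 h (Rlt_le_trans _ _ _ Hh (Rmin_r _ _))).
  set (k := (g (z + h) - g z)%C) in *.
  assert (K1 := Rlt_le_trans _ _ _ D3 (Rmin_l _ _)).
  assert (K2 := Rlt_le_trans _ _ _ D3 (Rmin_r _ _)).
  replace (f (z + h) * g (z + h) - f z * g z - (lf * g z + f z * lg) * h)%C
    with ((f (z + h) - f z - lf * h) * (g z + k) + lf * k * h + f z * (k - lg * h))%C
    by (unfold k; ring).
  eapply Rle_trans; [apply Cmod_triangle|].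
  eapply Rle_trans; [apply Rplus_le_compat_r, Cmod_triangle|].
  rewrite !Cmod_mult.
  pose proof (Cmod_ge_0 h). pose proof (Cmod_ge_0 k).
  assert (A1 : Cmod (f (z + h) - f z - lf * h)%C * Cmod (g z + k)%C <= eps / 3 * Cmod h).
  { apply Rle_trans with ((e1 * Cmod h) * (Cmod (g z) + 1)).
    - apply Rmult_le_compat; try apply Cmod_ge_0; trivial.
      eapply Rle_trans; [apply Cmod_triangle|]. lra.
    - right. unfold e1. field. lra. }
  assert (A2 : Cmod lf * Cmod k * Cmod h <= eps / 3 * Cmod h).
  { apply Rmult_le_compat_r; trivial.
    apply Rle_trans with (Cmod lf * (eps / 3 / (Cmod lf + 1))); [apply Rmult_le_compat_l; lra|].
    rewrite Rmult_comm. apply div_succ_mult_le; lra. }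
  assert (A3 : Cmod (f z) * Cmod (k - lg * h)%C <= eps / 3 * Cmod h).
  { apply Rle_trans with (Cmod (f z) * (e2 * Cmod h)); [apply Rmult_le_compat_l; lra|].
    rewrite <- Rmult_assoc. apply Rmult_le_compat_r; trivial. rewrite Rmult_comm.
    apply div_succ_mult_le; lra. }
  lra.
Qed.

Definition cis (t : R) : C := (cos t, sin t).
Definition cexp (z : C) : C := (exp (Re z) * cis (Im z))%C.

Lemma cis_plus (s t : R) : cis (s + t) = (cis s * cis t)%C.
Proof.
  unfold cis. rewrite cos_plus, sin_plus. apply injective_projections; simpl; ring.
Qed.

Lemma cis_0 : cis 0 = RtoC 1.
Proof. unfold cis. rewrite cos_0, sin_0. reflexivity. Qed.

Lemma Cmod_cis (t : R) : Cmod (cis t) = 1.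
Proof.
  unfold Cmod, cis; simpl. rewrite !Rmult_1_r.
  replace (cos t * cos t + sin t * sin t) with 1 by (pose proof (sin2_cos2 t); unfold Rsqr in *; lra).
  apply sqrt_1.
Qed.

Lemma cis_opp (t : R) : cis (- t) = Cconj (cis t).
Proof. unfold cis. rewrite cos_neg, sin_antisym. reflexivity. Qed.

Lemma cis_INR_mult (n : nat) (t : R) : cis (INR n * t) = (cis t ^ n)%C.
Proof.
  induction n as [|n IH].
  - simpl. rewrite Rmult_0_l. apply cis_0.
  - rewrite S_INR, Rmult_plus_distr_r, Rmult_1_l, cis_plus, IH. simpl. ring.
Qed.

Lemma cis_2PI : cis (2 * PI) = RtoC 1.
Proof. unfold cis. rewrite cos_2PI, sin_2PI. reflexivity. Qed.

Lemma cis_IZR_2PI (k : Z) : cis (IZR k * (2 * PI)) = RtoC 1.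
Proof.
  destruct k as [|p|p].
  - rewrite Rmult_0_l. apply cis_0.
  - rewrite <- Znat.positive_nat_Z, <- INR_IZR_INZ, cis_INR_mult, cis_2PI. apply Cpow_1_l.
  - change (Zneg p) with (- Zpos p)%Z. rewrite opp_IZR, Ropp_mult_distr_l_reverse, cis_opp,
      <- Znat.positive_nat_Z, <- INR_IZR_INZ, cis_INR_mult, cis_2PI, Cpow_1_l.
    apply injective_projections; simpl; ring.
Qed.

Lemma path_continuous_cis (k x : R) : path_continuous (fun t => cis (k * t)) x.
Proof.
  apply path_continuous_components.
  split; apply (ex_derive_continuous (V := R_NormedModule)); unfold cis; simpl; auto_derive; trivial.
Qed.

Lemma cexp_plus (w z : C) : cexp (w + z)%C = (cexp w * cexp z)%C.
Proof.
  unfold cexp. rewrite re_plus, im_plus, exp_plus, cis_plus, RtoC_mult. ring.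
Qed.

Lemma Cmod_cexp (z : C) : Cmod (cexp z) = exp (Re z).
Proof.
  unfold cexp. rewrite Cmod_mult, Cmod_cis, Cmod_R, Rmult_1_r.
  apply Rabs_pos_eq. left. apply exp_pos.
Qed.

Lemma derivable_pt_lim_0_eps (u : R -> R) (l : R) :
  derivable_pt_lim u 0 l -> forall eps, 0 < eps -> exists del, 0 < del /\
  forall y, Rabs y < del -> Rabs (u y - u 0 - l * y) <= eps * Rabs y.
Proof.
  intros H eps He. destruct (H eps He) as [d Hd].
  exists d. split; [apply cond_pos|]. intros y Hy.
  destruct (Req_dec y 0) as [->|Hn].
  { replace (u 0 - u 0 - l * 0) with 0 by ring. rewrite Rabs_R0. lra. }
  specialize (Hd y Hn Hy). rewrite Rplus_0_l in Hd.
  replace (u y - u 0 - l * y) with (((u y - u 0) / y - l) * y) by (field; trivial).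
  rewrite Rabs_mult. apply Rmult_le_compat_r; [apply Rabs_pos|lra].
Qed.

(** The addition formula reduces the claim to the origin, where the real derivatives of [exp], [cos]
    and [sin] at [0] give the expansion [cexp h = 1 + h + o(h)]. *)
Lemma is_Cderive_cexp (z : C) : is_Cderive cexp z (cexp z).
Proof.
  intros eps He.
  (* The three error terms below contribute [e], [4 e] and [e] times [Cmod h]; the constant [8]
     leaves room. The increment is also kept below [e], which makes the product [a * b] small of
     second order. *)
  set (e := Rmin (1 / 2) (eps / (8 * exp (Re z)))).
  assert (Pexp := exp_pos (Re z)).
  assert (Pe : 0 < e) by (apply Rmin_pos; [lra|apply Rdiv_lt_0_compat; lra]).
  assert (Le1 : e <= 1 / 2) by apply Rmin_l.
  assert (Le2 : exp (Re z) * (8 * e) <= eps).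
  { apply Rle_trans with (exp (Re z) * (8 * (eps / (8 * exp (Re z))))).
    - apply Rmult_le_compat_l; [lra|]. apply Rmult_le_compat_l; [lra|]. apply Rmin_r.
    - right. field. lra. }
  clearbody e.
  destruct (derivable_pt_lim_0_eps _ _ (derivable_pt_lim_exp 0) e Pe) as [d1 [Pd1 H1]].
  destruct (derivable_pt_lim_0_eps _ _ (derivable_pt_lim_cos 0) e Pe) as [d2 [Pd2 H2]].
  destruct (derivable_pt_lim_0_eps _ _ (derivable_pt_lim_sin 0) e Pe) as [d3 [Pd3 H3]].
  rewrite exp_0 in H1. rewrite cos_0, sin_0 in H2. rewrite cos_0, sin_0 in H3.
  exists (Rmin (Rmin d1 d2) (Rmin d3 e)). split; [repeat apply Rmin_pos; trivial|].
  intros h Hh.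
  assert (Ka := re_le_Cmod h). assert (Kb := im_le_Cmod h).
  set (a := Re h) in *. set (b := Im h) in *.
  assert (Q1 := Rlt_le_trans _ _ _ Hh (Rle_trans _ _ _ (Rmin_l _ _) (Rmin_l _ _))).
  assert (Q2 := Rlt_le_trans _ _ _ Hh (Rle_trans _ _ _ (Rmin_l _ _) (Rmin_r _ _))).
  assert (Q3 := Rlt_le_trans _ _ _ Hh (Rle_trans _ _ _ (Rmin_r _ _) (Rmin_l _ _))).
  assert (Q4 := Rlt_le_trans _ _ _ Hh (Rle_trans _ _ _ (Rmin_r _ _) (Rmin_r _ _))).
  specialize (H1 a ltac:(lra)). specialize (H2 b ltac:(lra)). specialize (H3 b ltac:(lra)).
  rewrite cexp_plus.
  replace (cexp z * cexp h - cexp z - cexp z * h)%C with (cexp z * (cexp h - 1 - h))%C by ring.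
  rewrite Cmod_mult, Cmod_cexp.
  assert (E : (cexp h - 1 - h)%C =
    (RtoC (exp a - 1 - 1 * a) * cis b + RtoC (1 + a) * (cis b - 1 - Ci * RtoC b) + Ci * RtoC (a * b))%C).
  { unfold cexp. fold a b. apply injective_projections; simpl; unfold a, b, Re, Im; ring. }
  assert (Hb : Cmod (cis b - 1 - Ci * RtoC b)%C <= 2 * e * Cmod h).
  { replace (cis b - 1 - Ci * RtoC b)%C with ((cos b - 1 - - 0 * b, sin b - 0 - 1 * b) : C)
      by (apply injective_projections; simpl; ring).
    eapply Rle_trans; [apply Cmod_pair_le|]. nra. }
  assert (Hcore : Cmod (cexp h - 1 - h)%C <= 8 * e * Cmod h).
  { rewrite E. eapply Rle_trans; [apply Cmod_triangle|].
    eapply Rle_trans; [apply Rplus_le_compat_r, Cmod_triangle|].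
    rewrite !Cmod_mult, Cmod_cis, Cmod_Ci, !Cmod_R, Rabs_mult.
    pose proof (Rabs_pos a). pose proof (Rabs_pos b). pose proof (Cmod_ge_0 h).
    assert (Rabs (1 + a) <= 2) by (apply Rabs_le; pose proof (Rabs_le_between a (Rabs a)); lra).
    assert (T1 : Rabs (exp a - 1 - 1 * a) * 1 <= e * Cmod h) by nra.
    assert (T2 : Rabs (1 + a) * Cmod (cis b - 1 - Ci * RtoC b)%C <= 2 * (2 * e * Cmod h)).
    { apply Rmult_le_compat; trivial; [apply Rabs_pos|apply Cmod_ge_0]. }
    assert (T3 : 1 * (Rabs a * Rabs b) <= e * Cmod h).
    { rewrite Rmult_1_l. apply Rmult_le_compat; trivial; lra. }
    pose proof (Rmult_le_pos e (Cmod h)). lra. }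
  pose proof (Cmod_ge_0 h).
  apply Rle_trans with (exp (Re z) * (8 * e * Cmod h)); [apply Rmult_le_compat_l; lra|].
  replace (exp (Re z) * (8 * e * Cmod h)) with (exp (Re z) * (8 * e) * Cmod h) by ring.
  apply Rmult_le_compat_r; trivial.
Qed.

(** * Fourier coefficients and Bessel's inequality *)

Fixpoint Rsum (u : nat -> R) (n : nat) : R :=
  match n with O => 0 | S m => Rsum u m + u m end.

Fixpoint Csum (u : nat -> C) (n : nat) : C :=
  match n with O => RtoC 0 | S m => (Csum u m + u m)%C end.

Definition avg (g : R -> C) : C := (RtoC (/ (2 * PI)) * CInt g 0 (2 * PI))%C.

Definition fourier (g : R -> C) (m : Z) : C := avg (fun t => cis (- IZR m * t) * g t)%C.

Definition pcont (g : R -> C) : Prop := forall t : R, path_continuous g t.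

Lemma pcont_mult (f g : R -> C) : pcont f -> pcont g -> pcont (fun t => f t * g t)%C.
Proof. intros Hf Hg t. apply path_continuous_mult; auto. Qed.

Lemma pcont_plus (f g : R -> C) : pcont f -> pcont g -> pcont (fun t => f t + g t)%C.
Proof. intros Hf Hg t. apply path_continuous_plus; auto. Qed.

Lemma pcont_minus (f g : R -> C) : pcont f -> pcont g -> pcont (fun t => f t - g t)%C.
Proof. intros Hf Hg t. apply path_continuous_minus; auto. Qed.

Lemma pcont_const (c : C) : pcont (fun _ => c).
Proof. intros t. apply path_continuous_const. Qed.

Lemma pcont_cis (k : R) : pcont (fun t => cis (k * t)).
Proof. intros t. apply path_continuous_cis. Qed.

Lemma pcont_conj (f : R -> C) : pcont f -> pcont (fun t => Cconj (f t)).
Proof. intros Hf t. apply path_continuous_conj; auto. Qed.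

#[local] Hint Resolve pcont_mult pcont_plus pcont_minus pcont_const pcont_cis pcont_conj : pcont.

Lemma two_PI_pos : 0 < 2 * PI.
Proof. pose proof PI_RGT_0. lra. Qed.

Lemma two_PI_ge0 : 0 <= 2 * PI.
Proof. left. apply two_PI_pos. Qed.

Lemma pcont_cont_on (g : R -> C) (a b : R) : pcont g -> cont_on g a b.
Proof. intros H t _. apply H. Qed.

Lemma avg_ext (f g : R -> C) : (forall t, f t = g t) -> avg f = avg g.
Proof. intros H. unfold avg. f_equal. apply CInt_ext; auto using two_PI_ge0. Qed.

Lemma avg_plus (f g : R -> C) : pcont f -> pcont g -> avg (fun t => f t + g t)%C = (avg f + avg g)%C.
Proof.
  intros Hf Hg. unfold avg. rewrite CInt_plus; auto using two_PI_ge0, pcont_cont_on. ring.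
Qed.

Lemma avg_minus (f g : R -> C) : pcont f -> pcont g -> avg (fun t => f t - g t)%C = (avg f - avg g)%C.
Proof.
  intros Hf Hg. unfold avg. rewrite CInt_minus; auto using two_PI_ge0, pcont_cont_on. ring.
Qed.

Lemma avg_scal (c : C) (g : R -> C) : pcont g -> avg (fun t => c * g t)%C = (c * avg g)%C.
Proof.
  intros Hg. unfold avg. rewrite CInt_scal; auto using two_PI_ge0, pcont_cont_on. ring.
Qed.

Lemma avg_const (c : C) : avg (fun _ => c) = c.
Proof.
  unfold avg. rewrite CInt_const, Rminus_0_r.
  pose proof two_PI_pos.
  rewrite (Cmult_comm c), Cmult_assoc, <- RtoC_mult, Rinv_l by lra. ring.
Qed.

Lemma avg_bound (g : R -> C) (B : R) : pcont g -> (forall t, Cmod (g t) <= B) -> Cmod (avg g) <= B.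
Proof.
  intros Hg HB. unfold avg. pose proof two_PI_pos.
  rewrite Cmod_mult, Cmod_R, Rabs_pos_eq by (left; apply Rinv_0_lt_compat; trivial).
  apply Rmult_le_reg_l with (2 * PI); trivial.
  rewrite <- Rmult_assoc, Rinv_r, Rmult_1_l by lra.
  eapply Rle_trans; [apply CInt_bound with (B := B); auto using two_PI_ge0, pcont_cont_on|].
  lra.
Qed.

Lemma CInt_conj (g : R -> C) (a b : R) :
  a <= b -> cont_on g a b -> CInt (fun t => Cconj (g t)) a b = Cconj (CInt g a b).
Proof.
  intros Hab Hg. unfold CInt, Cconj; simpl. f_equal.
  apply (RInt_opp (V := R_CompleteNormedModule) (fun t => Im (g t))).
  apply ex_RInt_Im; trivial.
Qed.

Lemma avg_conj (g : R -> C) : pcont g -> avg (fun t => Cconj (g t)) = Cconj (avg g).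
Proof.
  intros Hg. unfold avg. rewrite CInt_conj; auto using two_PI_ge0, pcont_cont_on.
  rewrite Cmult_conj. f_equal. apply injective_projections; simpl; ring.
Qed.

Lemma avg_cis (m : Z) : m <> 0%Z -> avg (fun t => cis (IZR m * t)) = RtoC 0.
Proof.
  intros Hm. assert (Hk : IZR m <> 0) by (apply not_0_IZR; trivial).
  assert (E : CInt (fun t => cis (IZR m * t)) 0 (2 * PI) = RtoC 0).
  { pose proof (cis_IZR_2PI m) as E. unfold cis in E.
    assert (Ec := f_equal fst E). assert (Es := f_equal snd E). simpl in Ec, Es.
    unfold CInt, cis. apply injective_projections; simpl; apply is_RInt_unique.
    - replace 0 with (minus (sin (IZR m * (2 * PI)) / IZR m) (sin (IZR m * 0) / IZR m)) at 2
        by (rewrite Es, Rmult_0_r, sin_0; unfold minus, plus, opp; simpl; field; trivial).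
      apply (is_RInt_derive (V := R_CompleteNormedModule) (fun t => sin (IZR m * t) / IZR m)).
      + intros t _. auto_derive; trivial. unfold Re. simpl. field. trivial.
      + intros t _. apply (ex_derive_continuous (V := R_NormedModule)). simpl. auto_derive. trivial.
    - replace 0 with (minus (- cos (IZR m * (2 * PI)) / IZR m) (- cos (IZR m * 0) / IZR m)) at 2
        by (rewrite Ec, Rmult_0_r, cos_0; unfold minus, plus, opp; simpl; field; trivial).
      apply (is_RInt_derive (V := R_CompleteNormedModule) (fun t => - cos (IZR m * t) / IZR m)).
      + intros t _. auto_derive; trivial. unfold Im. simpl. field. trivial.
      + intros t _. apply (ex_derive_continuous (V := R_NormedModule)). simpl. auto_derive. trivial. }
  unfold avg. rewrite E. ring.
Qed.

Lemma fourier_cis (k m : Z) :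
  fourier (fun t => cis (IZR k * t)) m = if Z.eq_dec k m then RtoC 1 else RtoC 0.
Proof.
  unfold fourier.
  rewrite (avg_ext _ (fun t => cis (IZR (k - m) * t))).
  - destruct Z.eq_dec as [->|Hn].
    + rewrite (avg_ext _ (fun _ => RtoC 1)); [apply avg_const|].
      intros t. rewrite Z.sub_diag, Rmult_0_l. apply cis_0.
    + apply avg_cis. lia.
  - intros t. rewrite <- cis_plus, minus_IZR. f_equal. ring.
Qed.

Lemma fourier_ext (f g : R -> C) (m : Z) : (forall t, f t = g t) -> fourier f m = fourier g m.
Proof. intros H. apply avg_ext. intros t. rewrite H. reflexivity. Qed.

Lemma fourier_plus (f g : R -> C) (m : Z) :
  pcont f -> pcont g -> fourier (fun t => f t + g t)%C m = (fourier f m + fourier g m)%C.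
Proof.
  intros Hf Hg. unfold fourier. rewrite <- avg_plus by auto with pcont.
  apply avg_ext. intros t. ring.
Qed.

Lemma fourier_minus (f g : R -> C) (m : Z) :
  pcont f -> pcont g -> fourier (fun t => f t - g t)%C m = (fourier f m - fourier g m)%C.
Proof.
  intros Hf Hg. unfold fourier. rewrite <- avg_minus by auto with pcont.
  apply avg_ext. intros t. ring.
Qed.

Lemma fourier_scal (c : C) (g : R -> C) (m : Z) :
  pcont g -> fourier (fun t => c * g t)%C m = (c * fourier g m)%C.
Proof.
  intros Hg. unfold fourier. rewrite <- avg_scal by auto with pcont.
  apply avg_ext. intros t. ring.
Qed.

Lemma fourier_bound (g : R -> C) (m : Z) (B : R) :
  pcont g -> (forall t, Cmod (g t) <= B) -> Cmod (fourier g m) <= B.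
Proof.
  intros Hg HB. apply avg_bound; auto with pcont.
  intros t. rewrite Cmod_mult, Cmod_cis, Rmult_1_l. apply HB.
Qed.

Lemma fourier_const (c : C) (m : Z) :
  fourier (fun _ => c) m = if Z.eq_dec 0 m then c else RtoC 0.
Proof.
  transitivity (c * fourier (fun t => cis (IZR 0 * t)) m)%C.
  - rewrite <- fourier_scal by auto with pcont. apply fourier_ext.
    intros t. rewrite Rmult_0_l, cis_0. ring.
  - rewrite fourier_cis. destruct Z.eq_dec; ring.
Qed.

Lemma fourier_shift (g : R -> C) (m : Z) :
  fourier (fun t => cis t * g t)%C m = fourier g (m - 1).
Proof.
  unfold fourier. apply avg_ext. intros t.
  rewrite Cmult_assoc, <- cis_plus, minus_IZR. do 2 f_equal. ring.
Qed.

(** The squared [L^2] norm on the circle, kept complex so that the linearity of [avg] applies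
    directly; inequalities are stated for its real part. *)
Definition energy (g : R -> C) : C := avg (fun t => g t * Cconj (g t))%C.

Lemma energy_ge0 (g : R -> C) : pcont g -> 0 <= Re (energy g).
Proof.
  intros Hg. unfold energy, avg. rewrite re_scal_l.
  pose proof two_PI_pos.
  apply Rmult_le_pos; [left; apply Rinv_0_lt_compat; trivial|].
  apply RInt_ge_0; [apply two_PI_ge0|apply ex_RInt_Re; auto using two_PI_ge0, pcont_cont_on with pcont|].
  intros t _. rewrite <- Cmod2_conj. rewrite re_RtoC. apply pow2_ge_0.
Qed.

Lemma energy_bound (g : R -> C) (B : R) :
  pcont g -> (forall t, Cmod (g t) <= B) -> Re (energy g) <= B ^ 2.
Proof.
  intros Hg HB. eapply Rle_trans; [apply Rle_abs|]. eapply Rle_trans; [apply re_le_Cmod|].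
  apply avg_bound; auto with pcont. intros t. rewrite Cmod_mult, Cmod_conj.
  pose proof (Cmod_ge_0 (g t)). specialize (HB t). simpl. nra.
Qed.

(** Pythagoras: what is left after removing the mode is orthogonal to it. *)
Lemma energy_minus_mode (g : R -> C) (m : Z) :
  pcont g ->
  energy (fun t => g t - fourier g m * cis (IZR m * t))%C
  = (energy g - RtoC (Cmod (fourier g m) ^ 2)%R)%C.
Proof.
  intros Hg. set (c := fourier g m).
  assert (E1 : avg (fun t => g t * Cconj (cis (IZR m * t)))%C = c).
  { unfold c, fourier. apply avg_ext. intros t.
    rewrite <- cis_opp, Ropp_mult_distr_l_reverse. ring. }
  assert (E2 : avg (fun t => cis (IZR m * t) * Cconj (g t))%C = Cconj c).
  { rewrite <- E1, <- avg_conj by auto with pcont. apply avg_ext. intros t.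
    rewrite Cmult_conj, Cconj_conj. ring. }
  unfold energy at 1.
  rewrite (avg_ext _ (fun t => (g t * Cconj (g t) + c * Cconj c)
      - (Cconj c * (g t * Cconj (cis (IZR m * t))) + c * (cis (IZR m * t) * Cconj (g t))))%C).
  - rewrite avg_minus, !avg_plus, !avg_scal, avg_const, E1, E2 by auto 10 with pcont.
    rewrite Cmod2_conj. unfold energy. ring.
  - intros t. rewrite Cminus_conj, Cmult_conj.
    assert (E : (cis (IZR m * t) * Cconj (cis (IZR m * t)))%C = RtoC 1).
    { rewrite <- Cmod2_conj, Cmod_cis. simpl. f_equal. ring. }
    transitivity (g t * Cconj (g t) + c * Cconj c * (cis (IZR m * t) * Cconj (cis (IZR m * t)))
      - (Cconj c * (g t * Cconj (cis (IZR m * t))) + c * (cis (IZR m * t) * Cconj (g t))))%C; [ring|].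
    rewrite E. ring.
Qed.

(** The injective list [k] of frequencies allows one proof for both ends of the spectrum: it is
    applied to [n] and to [-1 - n]. *)
Lemma bessel (g : R -> C) (k : nat -> Z) :
  pcont g -> (forall i j, k i = k j -> i = j) ->
  forall n, Rsum (fun j => Cmod (fourier g (k j)) ^ 2) n <= Re (energy g).
Proof.
  intros Hg Hk n.
  (* [r] is [g] without its first [n] listed modes. The coefficients still to be removed are
     unchanged, so the induction can strip them one at a time. *)
  assert (H : exists r, pcont r /\ (forall j, (n <= j)%nat -> fourier r (k j) = fourier g (k j)) /\
    energy r = (energy g - RtoC (Rsum (fun j => Cmod (fourier g (k j)) ^ 2)%R n))%C).
  { induction n as [|n [r [H1 [H2 H3]]]].
    - exists g. repeat split; auto. simpl. ring.
    - exists (fun t => r t - fourier r (k n) * cis (IZR (k n) * t))%C. repeat split.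
      + auto with pcont.
      + intros j Hj. rewrite fourier_minus, fourier_scal, fourier_cis by auto with pcont.
        destruct Z.eq_dec as [e|_]; [apply Hk in e; lia|]. rewrite H2 by lia. ring.
      + rewrite energy_minus_mode, H3, H2 by auto with pcont. cbn [Rsum]. rewrite RtoC_plus. ring. }
  destruct H as [r [H1 [_ H3]]].
  pose proof (energy_ge0 r H1) as H4.
  rewrite H3 in H4. unfold Cminus in H4. rewrite re_plus, re_opp, re_RtoC in H4. lra.
Qed.

(** * Series with nonnegative terms and their partial sums *)

Lemma sum_n_Rsum (u : nat -> R) (n : nat) : sum_n u n = Rsum u (S n).
Proof.
  induction n as [|n IH].
  - rewrite sum_O. simpl. ring.
  - rewrite sum_Sn, IH. reflexivity.
Qed.

Lemma Rsum_le_mono (u : nat -> R) (m n : nat) :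
  (forall k, 0 <= u k) -> (m <= n)%nat -> Rsum u m <= Rsum u n.
Proof.
  intros Hu Hmn. induction Hmn as [|n _ IH]; [lra|]. simpl. specialize (Hu n). lra.
Qed.

Lemma ex_series_Rsum_bounded (u : nat -> R) (B : R) :
  (forall k, 0 <= u k) -> (forall n, Rsum u n <= B) -> ex_series u.
Proof.
  intros Hu HB.
  destruct (ex_finite_lim_seq_incr (sum_n u) B) as [l Hl].
  - intros n. rewrite !sum_n_Rsum. apply Rsum_le_mono; auto.
  - intros n. rewrite sum_n_Rsum. apply HB.
  - exists l. exact Hl.
Qed.

Lemma ex_series_Rsum_le (u : nat -> R) :
  (forall k, 0 <= u k) -> ex_series u -> exists B, forall n, Rsum u n <= B.
Proof.
  intros Hu [l Hl]. exists l. intros n.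
  apply Rle_trans with (Rsum u (S n)); [apply Rsum_le_mono; auto|].
  rewrite <- sum_n_Rsum. apply (is_lim_seq_incr_compare (sum_n u)); [exact Hl|].
  intros m. rewrite !sum_n_Rsum. apply Rsum_le_mono; auto.
Qed.

Lemma square_summable_lim_0 (v : nat -> C) (B : R) :
  (forall n, Rsum (fun j => Cmod (v j) ^ 2) n <= B) ->
  forall eps, 0 < eps -> exists n0, forall n, (n0 <= n)%nat -> Cmod (v n) < eps.
Proof.
  intros HB eps He.
  assert (Hs : ex_series (fun j => Cmod (v j) ^ 2)).
  { apply ex_series_Rsum_bounded with B; trivial. intros j. apply pow2_ge_0. }
  apply ex_series_lim_0, is_lim_seq_spec in Hs.
  destruct (Hs (mkposreal (eps ^ 2) (pow_lt _ 2 He))) as [n0 Hn].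
  exists n0. intros n Hle. specialize (Hn n Hle). simpl pos in Hn.
  rewrite Rminus_0_r, Rabs_pos_eq in Hn by apply pow2_ge_0.
  pose proof (Cmod_ge_0 (v n)). simpl in Hn. nra.
Qed.

(** * Taylor expansion of bounded holomorphic functions *)

(** The parameter [s] is the logarithm of the radius, so the disk corresponds to [s < 0]. *)
Definition on_circle (f : C -> C) (s : R) (t : R) : C := f (cexp (s, t)).

Lemma Ccontinuous_cexp (z : C) : Ccontinuous cexp z.
Proof. apply (is_Cderive_continuous _ _ _ (is_Cderive_cexp z)). Qed.

Lemma cexp_in_disk (z : C) : Re z < 0 -> in_disk (cexp z).
Proof.
  intros H. unfold in_disk. rewrite Cmod_cexp, <- exp_0. apply exp_increasing; trivial.
Qed.

Lemma pcont_on_circle (f : C -> C) (s : R) :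
  (forall z, in_disk z -> Ccontinuous f z) -> s < 0 -> pcont (on_circle f s).
Proof.
  intros Hf Hs t. unfold on_circle.
  apply (path_continuous_vertical (fun w => f (cexp w)) s t).
  intros eps He.
  destruct (Hf (cexp (s, t)) (cexp_in_disk (s, t) Hs) eps He) as [d [Hd H1]].
  destruct (Ccontinuous_cexp (s, t) d Hd) as [e [He' H2]].
  exists e. split; trivial. intros h Hh. specialize (H1 _ (H2 h Hh)).
  replace (cexp (s, t) + (cexp ((s, t) + h) - cexp (s, t)))%C with (cexp ((s, t) + h)%C) in H1 by ring.
  exact H1.
Qed.

Lemma is_Cderive_scal_id (c z : C) : is_Cderive (fun w => c * w)%C z c.
Proof.
  intros eps He. exists 1. split; [lra|]. intros h _.
  replace (c * (z + h) - c * z - c * h)%C with (RtoC 0) by ring.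
  rewrite Cmod_0. apply Rmult_le_pos; [lra|apply Cmod_ge_0].
Qed.

Lemma RtoC_neq_0 (r : R) : r <> 0 -> RtoC r <> RtoC 0.
Proof. intros H E. apply H, RtoC_inj, E. Qed.

(* Goursat on the rectangle [s1,s2] x [0,2 pi] for the 2 pi i-periodic function
   f(e^w) e^{-mw}, whose horizontal sides cancel. *)
Lemma fourier_on_circle_scaling (f : C -> C) (m : Z) (s1 s2 : R) :
  (forall z, in_disk z -> exists l, is_Cderive f z l) -> s1 <= s2 -> s2 < 0 ->
  (RtoC (exp (- IZR m * s1)) * fourier (on_circle f s1) m
   = RtoC (exp (- IZR m * s2)) * fourier (on_circle f s2) m)%C.
Proof.
  intros Hf H12 H2.
  assert (Hc : forall z, in_disk z -> Ccontinuous f z).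
  { intros z Hz. destruct (Hf z Hz) as [l Hl]. apply (is_Cderive_continuous f z l Hl). }
  set (G := fun w : C => (f (cexp w) * cexp (RtoC (- IZR m) * w))%C).
  assert (HG : rect_int G s1 s2 0 (2 * PI) = RtoC 0).
  { apply goursat; trivial using two_PI_ge0.
    intros x y Hx Hy.
    destruct (Hf (cexp (x, y))) as [l Hl]; [apply cexp_in_disk; simpl; lra|].
    eexists. apply is_Cderive_mult.
    - apply (is_Cderive_comp f cexp); [exact Hl|apply is_Cderive_cexp].
    - apply (is_Cderive_comp cexp (fun w => RtoC (- IZR m) * w)%C);
        [apply is_Cderive_cexp|apply is_Cderive_scal_id]. }
  assert (EG : forall s t, G (s, t) =
    (RtoC (exp (- IZR m * s)) * (cis (- IZR m * t) * on_circle f s t))%C).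
  { intros s t. unfold G, on_circle.
    replace (RtoC (- IZR m) * (s, t))%C with ((- IZR m * s, - IZR m * t) : C)
      by (apply injective_projections; simpl; ring).
    unfold cexp at 2. simpl Re; simpl Im. ring. }
  assert (EV : forall s, s < 0 -> CInt (fun t => G (s, t)) 0 (2 * PI)
    = (RtoC (2 * PI) * (RtoC (exp (- IZR m * s)) * fourier (on_circle f s) m))%C).
  { intros s Hs. pose proof two_PI_pos.
    rewrite (CInt_ext _ (fun t => RtoC (exp (- IZR m * s)) * (cis (- IZR m * t) * on_circle f s t))%C)
      by (auto using two_PI_ge0).
    assert (Hp := pcont_on_circle f s Hc Hs).
    rewrite CInt_scal; auto using two_PI_ge0, pcont_cont_on, pcont_mult, pcont_cis.
    unfold fourier, avg. rewrite RtoC_inv by lra. field. apply RtoC_neq_0. lra. }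
  unfold rect_int in HG.
  rewrite (CInt_ext (fun x => G (x, 2 * PI)) (fun x => G (x, 0)) s1 s2) in HG.
  - rewrite !EV in HG by lra.
    pose proof two_PI_pos.
    set (A := (RtoC (exp (- IZR m * s1)) * fourier (on_circle f s1) m)%C) in *.
    set (B := (RtoC (exp (- IZR m * s2)) * fourier (on_circle f s2) m)%C) in *.
    assert (HG' : (Ci * RtoC (2 * PI) * (B - A))%C = RtoC 0) by (rewrite <- HG; ring).
    symmetry. apply Ceq_minus. destruct (Ceq_dec (B - A)%C (RtoC 0)) as [|Hn]; trivial.
    exfalso. revert HG'. apply Cmult_neq_0; trivial. apply Cmult_neq_0; [apply Ci_nz|].
    apply RtoC_neq_0. lra.
  - trivial.
  - intros x _. rewrite !EG. unfold on_circle, cexp. simpl Re; simpl Im.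
    rewrite cis_2PI, cis_0, Rmult_0_r, cis_0.
    replace (- IZR m * (2 * PI)) with (- (IZR m * (2 * PI))) by ring.
    rewrite cis_opp, cis_IZR_2PI. f_equal. f_equal. apply injective_projections; simpl; ring.
Qed.

(* The radius [exp (-1)] is immaterial, by [fourier_on_circle_scaling]. *)
Definition coeff (f : C -> C) (m : Z) : C :=
  (RtoC (exp (IZR m)) * fourier (on_circle f (-1)) m)%C.

Lemma fourier_on_circle (f : C -> C) (m : Z) (s : R) :
  (forall z, in_disk z -> exists l, is_Cderive f z l) -> s < 0 ->
  fourier (on_circle f s) m = (RtoC (exp (IZR m * s)) * coeff f m)%C.
Proof.
  intros Hf Hs.
  assert (E : (RtoC (exp (- IZR m * s)) * fourier (on_circle f s) m)%C = coeff f m).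
  { unfold coeff. replace (exp (IZR m)) with (exp (- IZR m * -1)) by (f_equal; ring).
    destruct (Rle_dec s (-1)) as [H|H].
    - apply fourier_on_circle_scaling; trivial; lra.
    - symmetry. apply fourier_on_circle_scaling; trivial; lra. }
  rewrite <- E, Cmult_assoc, <- RtoC_mult, <- exp_plus.
  replace (IZR m * s + - IZR m * s) with 0 by ring. rewrite exp_0. ring.
Qed.

Lemma exp_ge_opp_inv (x : R) : 0 < x -> exp (- x) < / x.
Proof.
  intros Hx. rewrite exp_Ropp. apply Rinv_lt_contravar.
  - apply Rmult_lt_0_compat; trivial. apply exp_pos.
  - pose proof (exp_ineq1 x). lra.
Qed.

(** For negative [m] the factor [exp (m s)] blows up as the circle shrinks to the origin, while the
    Fourier coefficient stays below [M]. *)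
Lemma coeff_neg (f : C -> C) (m : Z) (M : R) :
  (forall z, in_disk z -> exists l, is_Cderive f z l) ->
  (forall z, in_disk z -> Cmod (f z) <= M) -> (m < 0)%Z -> coeff f m = RtoC 0.
Proof.
  intros Hf HM Hm.
  assert (Hc : forall z, in_disk z -> Ccontinuous f z).
  { intros z Hz. destruct (Hf z Hz) as [l Hl]. apply (is_Cderive_continuous f z l Hl). }
  assert (HM0 : 0 <= M).
  { eapply Rle_trans; [apply Cmod_ge_0|apply (HM (RtoC 0))]. unfold in_disk. rewrite Cmod_0. lra. }
  assert (Hb : forall s, s < 0 -> Cmod (coeff f m) <= exp s * M).
  { intros s Hs.
    assert (HB : Cmod (fourier (on_circle f s) m) <= M).
    { apply fourier_bound; [apply pcont_on_circle; trivial|].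
      intros t. apply HM, cexp_in_disk. exact Hs. }
    rewrite fourier_on_circle, Cmod_mult, Cmod_R, Rabs_pos_eq in HB by (trivial; left; apply exp_pos).
    pose proof (Cmod_ge_0 (coeff f m)).
    assert (Hm1 : IZR m <= -1) by (apply IZR_le; lia).
    assert (He : exp (- s) <= exp (IZR m * s)).
    { destruct (Req_dec (- s) (IZR m * s)) as [->|]; [lra|]. left. apply exp_increasing. nra. }
    apply Rmult_le_reg_l with (exp (- s)); [apply exp_pos|].
    rewrite <- Rmult_assoc, <- exp_plus, Rplus_opp_l, exp_0, Rmult_1_l.
    eapply Rle_trans; [|exact HB]. apply Rmult_le_compat_r; trivial. }
  apply Cmod_eq_0. pose proof (Cmod_ge_0 (coeff f m)) as Hge.
  destruct (Rle_lt_or_eq_dec _ _ Hge) as [Hp|]; [|auto].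
  exfalso. set (e := Cmod (coeff f m)) in *.
  (* At log-radius [-x] the bound gives [e <= exp (-x) * M <= M / x = e * M / (M + 1) < e]. *)
  set (x := (M + 1) / e).
  assert (Hx : 0 < x) by (apply Rdiv_lt_0_compat; lra).
  specialize (Hb (- x) ltac:(lra)). pose proof (exp_ge_opp_inv x Hx).
  assert (exp (- x) * M <= / x * M) by (apply Rmult_le_compat_r; lra).
  assert (E : / x * M = e * (M / (M + 1))) by (unfold x; field; lra).
  assert (M / (M + 1) < 1).
  { apply Rmult_lt_reg_r with (M + 1); [lra|]. unfold Rdiv. rewrite Rmult_assoc, Rinv_l; lra. }
  nra.
Qed.

(* Bessel on the circle of radius [r = exp (- / (n + 1))], where [r ^ (2 k) >= exp (- 2)] for [k <= n]. *)
Lemma coeff_square_sum (f : C -> C) (M : R) :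
  (forall z, in_disk z -> exists l, is_Cderive f z l) ->
  (forall z, in_disk z -> Cmod (f z) <= M) ->
  forall n, Rsum (fun j => Cmod (coeff f (Z.of_nat j)) ^ 2) n <= exp 2 * M ^ 2.
Proof.
  intros Hf HM n.
  assert (Hc : forall z, in_disk z -> Ccontinuous f z).
  { intros z Hz. destruct (Hf z Hz) as [l Hl]. apply (is_Cderive_continuous f z l Hl). }
  set (s := - / (INR n + 1)).
  assert (Hn1 : 0 < INR n + 1) by (pose proof (pos_INR n); lra).
  assert (Hs : s < 0) by (unfold s; pose proof (Rinv_0_lt_compat _ Hn1); lra).
  assert (Hp := pcont_on_circle f s Hc Hs).
  assert (HB := Rle_trans _ _ _ (bessel (on_circle f s) Z.of_nat Hp Znat.Nat2Z.inj n)
    (energy_bound _ M Hp (fun t => HM _ (cexp_in_disk (s, t) Hs)))).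
  apply Rle_trans with (exp 2 * Rsum (fun j => Cmod (fourier (on_circle f s) (Z.of_nat j)) ^ 2) n);
    [|apply Rmult_le_compat_l; [left; apply exp_pos|exact HB]].
  assert (H : forall k, (k <= n)%nat -> Rsum (fun j => Cmod (coeff f (Z.of_nat j)) ^ 2) k <=
    exp 2 * Rsum (fun j => Cmod (fourier (on_circle f s) (Z.of_nat j)) ^ 2) k).
  { induction k as [|k IH]; intros Hk; [simpl; lra|].
    cbn [Rsum]. rewrite Rmult_plus_distr_l. apply Rplus_le_compat; [apply IH; lia|].
    rewrite fourier_on_circle, Cmod_mult, Cmod_R, Rabs_pos_eq by (trivial; left; apply exp_pos).
    rewrite Rpow_mult_distr, <- INR_IZR_INZ, <- Rmult_assoc.
    rewrite <- (Rmult_1_l (Cmod (coeff f (Z.of_nat k)) ^ 2)) at 1.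
    apply Rmult_le_compat_r; [apply pow2_ge_0|].
    simpl pow. rewrite Rmult_1_r, <- !exp_plus.
    assert (Hks : -1 <= INR k * s).
    { unfold s. assert (INR k <= INR n + 1) by (apply le_INR in Hk; rewrite S_INR in Hk; lra).
      apply Rmult_le_reg_r with (INR n + 1); trivial.
      replace (INR k * - / (INR n + 1) * (INR n + 1)) with (- INR k) by (field; lra). lra. }
    pose proof (exp_ineq1_le (2 + (INR k * s + INR k * s))). lra. }
  apply H. lia.
Qed.

(** The circle on which the difference quotient is expanded passes through [z] itself; the value [l]
    there fills the removable singularity when [l] is the derivative. *)
Definition slope (f : C -> C) (z l w : C) : C :=
  if Ceq_dec w z then l else ((f w - f z) / (w - z))%C.

Lemma slope_mult (f : C -> C) (z l w : C) : ((w - z) * slope f z l w)%C = (f w - f z)%C.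
Proof.
  unfold slope. destruct Ceq_dec as [->|Hn]; [ring|].
  field. apply Cminus_eq_contra; trivial.
Qed.

Lemma slope_continuous (f : C -> C) (z l w : C) :
  is_Cderive f z l -> Ccontinuous f w -> Ccontinuous (slope f z l) w.
Proof.
  intros Hl Hc eps He. destruct (Ceq_dec w z) as [->|Hn].
  - destruct (Hl (eps / 2) ltac:(lra)) as [d [Hd H1]]. exists d. split; trivial.
    intros h Hh. unfold slope at 2. destruct Ceq_dec as [_|Hf]; [|congruence].
    unfold slope. destruct Ceq_dec as [_|Hf].
    + replace (l - l)%C with (RtoC 0) by ring. rewrite Cmod_0. trivial.
    + assert (Hh0 : h <> RtoC 0) by (intros ->; apply Hf; ring).
      replace ((f (z + h) - f z) / (z + h - z) - l)%C with ((f (z + h) - f z - l * h) / h)%C.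
      * rewrite Cmod_div by trivial. apply Cmod_gt_0 in Hh0.
        apply Rle_lt_trans with (eps / 2); [|lra].
        apply Rmult_le_reg_r with (Cmod h); trivial.
        unfold Rdiv at 1. rewrite Rmult_assoc, Rinv_l, Rmult_1_r by lra. apply H1; trivial.
      * replace (z + h - z)%C with h by ring. field. trivial.
  - assert (HD : (w - z)%C <> RtoC 0) by (apply Cminus_eq_contra; trivial).
    set (D := (w - z)%C) in *. set (F := (f w - f z)%C).
    assert (PD : 0 < Cmod D) by (apply Cmod_gt_0; trivial).
    pose proof (Cmod_ge_0 F) as PF.
    (* The difference of the two quotients has numerator at most [eps |D|^2 / 4] and denominator at
       least [|D|^2 / 2]. *)
    set (e1 := eps * Cmod D / 8). set (e2 := eps * Cmod D ^ 2 / 8 / (Cmod F + 1)).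
    assert (PD2 : 0 < Cmod D ^ 2) by (apply pow_lt; trivial).
    assert (P1 : 0 < e1) by (unfold e1; nra).
    assert (P2 : 0 < e2) by (apply Rdiv_lt_0_compat; nra).
    destruct (Hc e1 P1) as [d [Hd H1]].
    exists (Rmin d (Rmin e2 (Cmod D / 2))). split; [repeat apply Rmin_pos; trivial; lra|].
    intros h Hh.
    assert (K1 := Rlt_le_trans _ _ _ Hh (Rmin_l _ _)).
    assert (K2 := Rlt_le_trans _ _ _ Hh (Rle_trans _ _ _ (Rmin_r _ _) (Rmin_l _ _))).
    assert (K3 := Rlt_le_trans _ _ _ Hh (Rle_trans _ _ _ (Rmin_r _ _) (Rmin_r _ _))).
    specialize (H1 h K1).
    assert (LD : Cmod D / 2 <= Cmod (D + h)%C).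
    { pose proof (Cmod_triangle (D + h)%C (- h)%C) as T. rewrite Cmod_opp in T.
      replace (D + h + - h)%C with D in T by ring. lra. }
    assert (HDh : (D + h)%C <> RtoC 0) by (apply Cmod_gt_0; lra).
    unfold slope. destruct Ceq_dec as [E|_].
    { exfalso. apply HDh. unfold D. replace z with (w + h)%C at 1 by exact E. ring. }
    destruct Ceq_dec as [E|_]; [congruence|]. fold D.
    set (phi := (f (w + h) - f w)%C) in *.
    replace ((f (w + h) - f z) / (w + h - z) - (f w - f z) / D)%C
      with ((phi * D - F * h) / ((D + h) * D))%C.
    + rewrite Cmod_div, (Cmod_mult (D + h)%C) by (apply Cmult_neq_0; trivial).
      assert (HN : Cmod (phi * D - F * h)%C <= eps * Cmod D ^ 2 / 4).
      { unfold Cminus. eapply Rle_trans; [apply Cmod_triangle|]. rewrite Cmod_opp, !Cmod_mult.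
        assert (Cmod phi * Cmod D <= e1 * Cmod D) by (apply Rmult_le_compat_r; lra).
        assert (Cmod F * Cmod h <= Cmod F * e2) by (apply Rmult_le_compat_l; lra).
        assert (e2 * Cmod F <= eps * Cmod D ^ 2 / 8) by (apply div_succ_mult_le; [nra|lra]).
        unfold e1 in *. lra. }
      apply Rmult_lt_reg_r with (Cmod (D + h)%C * Cmod D); [nra|].
      unfold Rdiv at 1. rewrite Rmult_assoc, Rinv_l, Rmult_1_r by nra.
      eapply Rle_lt_trans; [apply HN|].
      assert (eps * (Cmod D / 2 * Cmod D) <= eps * (Cmod (D + h)%C * Cmod D)).
      { apply Rmult_le_compat_l; [lra|]. apply Rmult_le_compat_r; lra. }
      nra.
    + unfold phi, F. replace (w + h - z)%C with (D + h)%C by (unfold D; ring).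
      replace (f (w + h) - f w)%C with ((f (w + h) - f z) - (f w - f z))%C by ring.
      field. split; trivial.
Qed.

(* With [g = slope f z l] on the circle through [z], the coefficient relation
   [fourier f m = f z * [m = 0] + e^s * fourier g (m - 1) - z * fourier g m] makes the Taylor sum telescope;
   both remainders vanish because the coefficients of [g] tend to [0] at both ends. *)
Lemma taylor_converges (f : C -> C) (M : R) (z : C) :
  (forall w, in_disk w -> exists l, is_Cderive f w l) ->
  (forall w, in_disk w -> Cmod (f w) <= M) -> in_disk z -> z <> RtoC 0 ->
  forall eps, 0 < eps -> exists n0, forall n, (n0 <= n)%nat ->
    Cmod (Csum (fun k => coeff f (Z.of_nat k) * z ^ k)%C n - f z)%C < eps.
Proof.
  intros Hf HM Hz Hz0 eps He.
  assert (Hc : forall w, in_disk w -> Ccontinuous f w).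
  { intros w Hw. destruct (Hf w Hw) as [l Hl]. apply (is_Cderive_continuous f w l Hl). }
  assert (Pz : 0 < Cmod z) by (apply Cmod_gt_0; trivial).
  set (s := ln (Cmod z)).
  assert (Es : exp s = Cmod z) by (apply exp_ln; trivial).
  assert (Hs : s < 0) by (unfold s; rewrite <- ln_1; apply ln_increasing; trivial).
  destruct (Hf z Hz) as [l Hl].
  set (g := on_circle (slope f z l) s).
  assert (Hg : pcont g) by (apply pcont_on_circle; trivial; intros w Hw; apply slope_continuous; auto).
  set (r := Cmod z) in *.
  assert (E : forall t, on_circle f s t = (f z + (RtoC r * (cis t * g t) - z * g t))%C).
  { intros t. unfold g, on_circle.
    set (w := cexp (s, t)).
    replace (RtoC r * (cis t * slope f z l w))%C with (w * slope f z l w)%C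
      by (unfold w, cexp; simpl Re; simpl Im; rewrite Es; ring).
    replace (w * slope f z l w - z * slope f z l w)%C with ((w - z) * slope f z l w)%C by ring.
    rewrite slope_mult. ring. }
  assert (EF : forall m, (RtoC (exp (IZR m * s)) * coeff f m)%C =
    ((if Z.eq_dec 0 m then f z else 0) + (RtoC r * fourier g (m - 1) - z * fourier g m))%C).
  { intros m. rewrite <- fourier_on_circle by trivial.
    rewrite (fourier_ext _ _ m E).
    assert (Hcg : pcont (fun t => cis t * g t)%C).
    { apply pcont_mult; trivial. intros t. apply path_continuous_ext with (fun t => cis (1 * t)).
      - intros u. rewrite Rmult_1_l. reflexivity.
      - apply path_continuous_cis. }
    rewrite fourier_plus, fourier_minus, !fourier_scal, fourier_const, fourier_shift;
      auto using pcont_mult, pcont_minus, pcont_const. }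
  (* At negative indices the coefficients of [f] vanish, and since [|z| = r] the relation makes all
     [|fourier g (-1 - n)|] equal; by Bessel they tend to [0], hence they are [0]. *)
  assert (Hneg : fourier g (-1) = RtoC 0).
  { assert (Hcst : forall n : nat, Cmod (fourier g (-1 - Z.of_nat n)) = Cmod (fourier g (-1))).
    { induction n as [|n IH]; [reflexivity|].
      rewrite <- IH. specialize (EF (-1 - Z.of_nat n)%Z).
      rewrite (coeff_neg f _ M) in EF by (trivial; lia).
      destruct Z.eq_dec as [?|_]; [lia|].
      replace (-1 - Z.of_nat n - 1)%Z with (-1 - Z.of_nat (S n))%Z in EF by lia.
      assert (EF' : (RtoC r * fourier g (-1 - Z.of_nat (S n)))%C = (z * fourier g (-1 - Z.of_nat n))%C).
      { apply Ceq_minus. rewrite <- (Cplus_0_l (_ - _)%C). rewrite <- EF. ring. }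
      apply (f_equal Cmod) in EF'. rewrite !Cmod_mult, Cmod_R, Rabs_pos_eq in EF' by lra.
      apply Rmult_eq_reg_l with r; [exact EF'|lra]. }
    apply Cmod_eq_0. pose proof (Cmod_ge_0 (fourier g (-1))) as Hge.
    destruct (Rle_lt_or_eq_dec _ _ Hge) as [Hp|]; [|auto]. exfalso.
    assert (Hinj : forall i j : nat, (-1 - Z.of_nat i)%Z = (-1 - Z.of_nat j)%Z -> i = j) by (intros; lia).
    destruct (square_summable_lim_0 (fun n => fourier g (-1 - Z.of_nat n)) _
      (bessel g (fun n => -1 - Z.of_nat n)%Z Hg Hinj) _ Hp) as [n Hn].
    specialize (Hn n (le_n n)). cbv beta in Hn. rewrite Hcst in Hn. lra. }
  (* Dividing out the radius leaves a unimodular number, so its powers in the telescoped remainder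
     do not affect the size. *)
  set (zeta := (z / RtoC r)%C).
  assert (Hr0 : RtoC r <> RtoC 0) by (apply RtoC_neq_0; lra).
  assert (Ez : (RtoC r * zeta)%C = z) by (unfold zeta; field; trivial).
  assert (Mz : Cmod zeta = 1).
  { unfold zeta. rewrite Cmod_div, Cmod_R, Rabs_pos_eq by (trivial; lra). fold r. field. lra. }
  assert (ES : forall n, Csum (fun k => coeff f (Z.of_nat k) * z ^ k)%C (S n) =
    (f z - RtoC r * fourier g (Z.of_nat n) * zeta ^ S n)%C).
  { assert (Et : forall k : nat, (coeff f (Z.of_nat k) * z ^ k)%C =
      (((if Z.eq_dec 0 (Z.of_nat k) then f z else 0)
       + (RtoC r * fourier g (Z.of_nat k - 1) - z * fourier g (Z.of_nat k))) * zeta ^ k)%C).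
    { intros k. rewrite <- EF, <- INR_IZR_INZ.
      assert (Ek : exp (INR k * s) = r ^ k).
      { exact (Rpower_pow k r Pz). }
      rewrite Ek, RtoC_pow. rewrite <- Ez at 1. rewrite Cpow_mult_l. ring. }
    induction n as [|n IH].
    - cbn [Csum]. rewrite Et. simpl Z.of_nat. destruct Z.eq_dec as [_|]; [|lia].
      change (0 - 1)%Z with (-1)%Z. rewrite Hneg. simpl. rewrite <- Ez at 2. ring.
    - cbn [Csum] in *. rewrite IH, Et. destruct Z.eq_dec as [|_]; [lia|].
      replace (Z.of_nat (S n) - 1)%Z with (Z.of_nat n) by lia.
      rewrite <- Ez at 2. rewrite !Cpow_S. ring. }
  destruct (square_summable_lim_0 (fun n => fourier g (Z.of_nat n)) _
    (bessel g Z.of_nat Hg Znat.Nat2Z.inj) eps He) as [n0 Hn0].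
  exists (S n0). intros [|n] Hn; [lia|].
  rewrite ES.
  replace (f z - RtoC r * fourier g (Z.of_nat n) * zeta ^ S n - f z)%C
    with (- (RtoC r * fourier g (Z.of_nat n) * zeta ^ S n))%C by ring.
  rewrite Cmod_opp, !Cmod_mult, Cmod_pow, Mz, pow1, Cmod_R, Rabs_pos_eq, Rmult_1_r by lra.
  specialize (Hn0 n ltac:(lia)). cbv beta in Hn0.
  pose proof (Cmod_ge_0 (fourier g (Z.of_nat n))).
  unfold in_disk in Hz. fold r in Hz. nra.
Qed.

(** * Sampling on equally spaced points *)

Lemma H_infty_taylor (f : C -> C) :
  H_infty f -> not_identically_zero f ->
  exists a : nat -> C,
    (forall eps, 0 < eps -> exists n0, forall n, (n0 <= n)%nat -> Cmod (a n) < eps) /\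
    (exists m, a m <> RtoC 0) /\
    (forall z, in_disk z -> z <> RtoC 0 -> forall eps, 0 < eps ->
       exists n0, forall n, (n0 <= n)%nat -> Cmod (Csum (fun k => a k * z ^ k)%C n - f z)%C < eps).
Proof.
  intros [Hd [M HM]] [z0 [Hz0 Hfz0]].
  assert (Hf : forall z, in_disk z -> exists l, is_Cderive f z l).
  { intros z Hz. destruct (Hd z Hz) as [l Hl]. exists l. apply is_derive_Cderive, Hl. }
  exists (fun n => coeff f (Z.of_nat n)).
  assert (Hconv := fun z => taylor_converges f M z Hf HM).
  repeat split; trivial.
  - exact (square_summable_lim_0 _ _ (coeff_square_sum f M Hf HM)).
  - apply NNPP. intros Hno.
    assert (H0 : forall z, in_disk z -> z <> RtoC 0 -> f z = RtoC 0).
    { intros z Hz Hzn. destruct (Ceq_dec (f z) (RtoC 0)) as [|Hn]; trivial. exfalso.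
      apply Cmod_gt_0 in Hn.
      destruct (Hconv z Hz Hzn (Cmod (f z)) Hn) as [n Hlt].
      specialize (Hlt n (le_n n)).
      assert (E : forall n, Csum (fun k => coeff f (Z.of_nat k) * z ^ k)%C n = RtoC 0).
      { induction n0 as [|k IH]; [reflexivity|]. cbn [Csum]. rewrite IH.
        destruct (Ceq_dec (coeff f (Z.of_nat k)) (RtoC 0)) as [->|Hk]; [ring|].
        exfalso. apply Hno. exists k. trivial. }
      rewrite E in Hlt. unfold Cminus in Hlt. rewrite Cplus_0_l, Cmod_opp in Hlt. lra. }
    (* The expansion is only available off the origin, so a nonzero value at [0] is excluded by
       continuity at a small positive real [h]. *)
    destruct (Ceq_dec z0 (RtoC 0)) as [->|Hzn]; [|apply Hfz0, H0; trivial].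
    destruct (Hf _ Hz0) as [l Hl]. apply is_Cderive_continuous in Hl.
    apply Cmod_gt_0 in Hfz0.
    destruct (Hl _ Hfz0) as [d [Pd Hc]].
    set (h := Rmin d 1 / 2).
    assert (P1 : 0 < Rmin d 1) by (apply Rmin_pos; lra).
    assert (P2 := Rmin_l d 1). assert (P3 := Rmin_r d 1).
    assert (Mh : Cmod (RtoC h) = h) by (rewrite Cmod_R; apply Rabs_pos_eq; unfold h; lra).
    specialize (Hc (RtoC h)). rewrite Mh, Cplus_0_l, H0 in Hc.
    + unfold Cminus in Hc. rewrite Cplus_0_l, Cmod_opp in Hc. unfold h in Hc. lra.
    + unfold in_disk. rewrite Mh. unfold h. lra.
    + apply RtoC_neq_0. unfold h. lra.
Qed.

Lemma Csum_ext (u v : nat -> C) (n : nat) :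
  (forall k, (k < n)%nat -> u k = v k) -> Csum u n = Csum v n.
Proof.
  induction n as [|n IH]; intros H; [reflexivity|].
  cbn [Csum]. rewrite IH, H; auto.
Qed.

Lemma Csum_plus (u v : nat -> C) (n : nat) :
  Csum (fun k => u k + v k)%C n = (Csum u n + Csum v n)%C.
Proof.
  induction n as [|n IH]; cbn [Csum]; [ring|]. rewrite IH. ring.
Qed.

Lemma Csum_mult_l (c : C) (u : nat -> C) (n : nat) :
  Csum (fun k => c * u k)%C n = (c * Csum u n)%C.
Proof.
  induction n as [|n IH]; cbn [Csum]; [ring|]. rewrite IH. ring.
Qed.

Lemma Csum_exchange (u : nat -> nat -> C) (m n : nat) :
  Csum (fun i => Csum (u i) n) m = Csum (fun j => Csum (fun i => u i j) m) n.
Proof.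
  induction m as [|m IH]; cbn [Csum].
  - induction n as [|n IHn]; cbn [Csum]; [reflexivity|]. rewrite <- IHn. ring.
  - rewrite IH, Csum_plus. reflexivity.
Qed.

Lemma Csum_add (u : nat -> C) (m n : nat) :
  Csum u (m + n) = (Csum u m + Csum (fun k => u (m + k)%nat) n)%C.
Proof.
  induction n as [|n IH]; cbn [Csum]; [rewrite Nat.add_0_r; ring|].
  rewrite Nat.add_succ_r. cbn [Csum]. rewrite IH. ring.
Qed.

Lemma Csum_zero (u : nat -> C) (n : nat) :
  (forall k, (k < n)%nat -> u k = RtoC 0) -> Csum u n = RtoC 0.
Proof.
  induction n as [|n IH]; intros H; [reflexivity|].
  cbn [Csum]. rewrite IH, H; auto. ring.
Qed.

Lemma Csum_single (u : nat -> C) (m n : nat) :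
  (m < n)%nat -> (forall k, (k < n)%nat -> k <> m -> u k = RtoC 0) -> Csum u n = u m.
Proof.
  induction n as [|n IH]; intros Hm H; [lia|]. cbn [Csum].
  destruct (Nat.eq_dec m n) as [->|Hn].
  - rewrite Csum_zero; [ring|]. intros k Hk. apply H; lia.
  - rewrite IH by (try lia; intros; apply H; lia). rewrite (H n) by lia. ring.
Qed.

Lemma Cmod_Csum_le (u : nat -> C) (n : nat) : Cmod (Csum u n) <= Rsum (fun k => Cmod (u k)) n.
Proof.
  induction n as [|n IH]; simpl; [rewrite Cmod_0; lra|].
  eapply Rle_trans; [apply Cmod_triangle|]. lra.
Qed.

Lemma Rsum_le (u v : nat -> R) (n : nat) :
  (forall k, (k < n)%nat -> u k <= v k) -> Rsum u n <= Rsum v n.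
Proof.
  induction n as [|n IH]; intros H; simpl; [lra|].
  apply Rplus_le_compat; [apply IH|apply H]; auto.
Qed.

Lemma Rsum_plus_const (u : nat -> R) (c : R) (n : nat) :
  Rsum (fun k => u k + c) n = Rsum u n + INR n * c.
Proof.
  induction n as [|n IH]; cbn [Rsum]; [simpl; ring|]. rewrite IH, S_INR. ring.
Qed.

Lemma Csum_geom (z : C) (n : nat) : ((z - 1) * Csum (fun j => z ^ j) n)%C = (z ^ n - 1)%C.
Proof.
  induction n as [|n IH]; cbn [Csum]; [simpl; ring|].
  rewrite Cmult_plus_distr_l, IH, Cpow_S. ring.
Qed.

Definition root (N : nat) : C := cis (2 * PI / INR N).

Lemma Cmod_root_pow (N k : nat) : Cmod (root N ^ k)%C = 1.
Proof. unfold root. rewrite Cmod_pow, Cmod_cis. apply pow1. Qed.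

Lemma root_pow_N (N : nat) : (0 < N)%nat -> (root N ^ N)%C = RtoC 1.
Proof.
  intros HN. unfold root. rewrite <- cis_INR_mult, <- cis_2PI. f_equal. field.
  apply not_0_INR. lia.
Qed.

Lemma root_pow_neq_1 (N k : nat) : (0 < k < N)%nat -> (root N ^ k)%C <> RtoC 1.
Proof.
  intros [Hk HkN] E. unfold root in E. rewrite <- cis_INR_mult in E.
  apply (f_equal fst) in E. unfold cis in E; simpl in E.
  set (x := INR k * (2 * PI / INR N)) in *.
  apply lt_INR in HkN. apply lt_INR in Hk. simpl in Hk.
  pose proof PI_RGT_0.
  assert (Ex : x = 2 * (PI * (INR k / INR N))) by (unfold x; field; lra).
  assert (H0 : 0 < INR k / INR N) by (apply Rdiv_lt_0_compat; lra).
  assert (H1 : INR k / INR N < 1).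
  { apply Rmult_lt_reg_r with (INR N); [lra|]. unfold Rdiv. rewrite Rmult_assoc, Rinv_l; lra. }
  rewrite Ex, cos_2a_sin in E.
  assert (Hsin : 0 < sin (PI * (INR k / INR N))) by (apply sin_gt_0; nra).
  nra.
Qed.

(** The range is that of the exponents [N - m + k] with [m, k < N], in which [N] is the only
    multiple of [N]. *)
Lemma Csum_root_pow (N e : nat) :
  (0 < e < 2 * N)%nat ->
  Csum (fun j => (root N ^ e) ^ j)%C N = if Nat.eq_dec e N then RtoC (INR N) else RtoC 0.
Proof.
  intros He. destruct Nat.eq_dec as [->|Hn].
  - rewrite root_pow_N by lia. clear He. generalize N. intros n.
    induction n as [|n IH]; [reflexivity|].
    cbn [Csum]. rewrite IH, Cpow_1_l, S_INR, RtoC_plus. reflexivity.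
  - assert (Hz : (root N ^ e)%C <> RtoC 1).
    { destruct (Nat.lt_ge_cases e N) as [H|H]; [apply root_pow_neq_1; lia|].
      replace e with (N + (e - N))%nat by lia.
      rewrite Cpow_add_r, root_pow_N, Cmult_1_l by lia. apply root_pow_neq_1; lia. }
    pose proof (Csum_geom (root N ^ e)%C N) as Hg.
    rewrite <- (Cpow_mult_r (root N) e N), (Nat.mul_comm e N), Cpow_mult_r, root_pow_N, Cpow_1_l in Hg by lia.
    set (S := Csum (fun j => (root N ^ e) ^ j)%C N) in *.
    destruct (Ceq_dec S (RtoC 0)) as [|HS]; trivial.
    exfalso. apply (Cmult_neq_0 (root N ^ e - 1)%C S); trivial; [apply Cminus_eq_contra; trivial|].
    rewrite Hg. ring.
Qed.

(* Aliasing: sampling at the [N]-th roots of unity only sees the exponents congruent to [m] modulo [N]. *)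
Lemma sample_polynomial (a : nat -> C) (r : R) (N m L : nat) :
  (m < N)%nat ->
  Csum (fun j => (root N ^ (N - m)) ^ j * Csum (fun k => a k * (RtoC r * root N ^ j) ^ k) (N * L))%C N
  = (RtoC (INR N) * Csum (fun l => a (N * l + m)%nat * RtoC (r ^ (N * l + m))%R) L)%C.
Proof.
  intros Hm.
  transitivity (Csum (fun k => a k * RtoC (r ^ k)%R * Csum (fun j => (root N ^ (N - m + k)) ^ j) N)%C (N * L)).
  - rewrite (Csum_ext _ (fun j => Csum (fun k =>
      (root N ^ (N - m)) ^ j * (a k * (RtoC r * root N ^ j) ^ k)) (N * L))%C)
      by (intros; symmetry; apply Csum_mult_l).
    rewrite Csum_exchange. apply Csum_ext. intros k _.
    rewrite <- Csum_mult_l. apply Csum_ext. intros j _.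
    rewrite Cpow_mult_l, RtoC_pow, Cpow_add_r, Cpow_mult_l, <- !Cpow_mult_r, (Nat.mul_comm j k). ring.
  - induction L as [|L IH]; [rewrite Nat.mul_0_r; cbn [Csum]; ring|].
    rewrite Nat.mul_succ_r, Csum_add, IH. cbn [Csum].
    rewrite Cmult_plus_distr_l. f_equal.
    (* The character of frequency [-m] is written with exponent [N - m] to stay in [nat]. Each block
       of [N] consecutive exponents then behaves like the first and contributes only its term
       [k = m]. *)
    assert (E : forall k, (root N ^ (N - m + (N * L + k)))%C = (root N ^ (N - m + k))%C).
    { intros k. replace (N - m + (N * L + k))%nat with (N * L + (N - m + k))%nat by lia.
      rewrite Cpow_add_r, Cpow_mult_r, root_pow_N, Cpow_1_l by lia. ring. }
    rewrite (Csum_single _ m).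
    + rewrite E, Csum_root_pow by lia. destruct Nat.eq_dec; [ring|lia].
    + lia.
    + intros k Hk Hkm. rewrite E, Csum_root_pow by lia. destruct Nat.eq_dec; [lia|ring].
Qed.

Lemma eventually_forall_lt (P : nat -> nat -> Prop) (N : nat) :
  (forall j, exists n0, forall n, (n0 <= n)%nat -> P j n) ->
  exists n0, forall n, (n0 <= n)%nat -> forall j, (j < N)%nat -> P j n.
Proof.
  intros H. induction N as [|N [n1 IH]].
  - exists 0%nat. intros; lia.
  - destruct (H N) as [n2 H2]. exists (max n1 n2). intros n Hn j Hj.
    destruct (Nat.eq_dec j N) as [->|]; [apply H2|apply IH]; lia.
Qed.

(** With [|a_m| = 2 eta] and all later aliased coefficients below [eta], the condition [r^N <= 1/2]
    bounds the aliased tail by [eta r^m (1/2 + 1/4 + ...)], half of the main term. *)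
Lemma sampling (f : C -> C) :
  H_infty f -> not_identically_zero f ->
  exists (delta : R) (N0 : nat), 0 < delta /\
    forall (N : nat) (r : R), (N0 <= N)%nat -> 1 / 2 <= r < 1 -> r ^ N <= 1 / 2 ->
      INR N * delta <= Rsum (fun j => Cmod (f (RtoC r * root N ^ j)%C)) N.
Proof.
  intros Hf Hnz. destruct (H_infty_taylor f Hf Hnz) as [a [Ha0 [[m Hm] Hconv]]].
  apply Cmod_gt_0 in Hm.
  set (eta := Cmod (a m) / 2).
  destruct (Ha0 eta ltac:(unfold eta; lra)) as [n1 Hn1].
  assert (Phm : 0 < (1 / 2) ^ m) by (apply pow_lt; lra).
  (* [S m] ensures [m < N], and [n1] puts every aliased index [N (l + 1) + m] where the coefficients
     are below [eta]. The power of [1 / 2] bounds [r^m] from below uniformly in [r]. *)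
  exists ((1 / 2) ^ m * eta), (max n1 (S m)). split; [unfold eta; nra|].
  intros N r HN Hr HrN.
  assert (Prm : (1 / 2) ^ m <= r ^ m) by (apply pow_incr; lra).
  assert (HN0 : 0 < INR N) by (apply lt_0_INR; lia).
  set (b := fun l => (a (N * l + m)%nat * RtoC (r ^ (N * l + m))%R)%C).
  assert (Hb : forall l, Cmod (b (S l)) <= eta * r ^ m * (1 / 2) ^ S l).
  { intros l. unfold b. rewrite Cmod_mult, Cmod_R, Rabs_pos_eq by (apply pow_le; lra).
    rewrite pow_add, pow_mult.
    assert (Cmod (a (N * S l + m)%nat) < eta) by (apply Hn1; nia).
    assert ((r ^ N) ^ S l <= (1 / 2) ^ S l).
    { apply pow_incr. split; [apply pow_le; lra|trivial]. }
    assert (0 <= (r ^ N) ^ S l) by (apply pow_le, pow_le; lra).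
    assert (0 <= r ^ m) by lra.
    replace (eta * r ^ m * (1 / 2) ^ S l) with (eta * ((1 / 2) ^ S l * r ^ m)) by ring.
    apply Rmult_le_compat; [apply Cmod_ge_0|apply Rmult_le_pos; trivial|lra|].
    apply Rmult_le_compat_r; trivial. }
  assert (Htail : forall L, Cmod (Csum b (S L) - b 0%nat)%C <= eta * r ^ m * (1 - (1 / 2) ^ L)).
  { induction L as [|L IH].
    - cbn [Csum]. replace (0 + b 0%nat - b 0%nat)%C with (RtoC 0) by ring. rewrite Cmod_0. simpl. lra.
    - change (Csum b (S (S L))) with (Csum b (S L) + b (S L))%C.
      replace (Csum b (S L) + b (S L) - b 0%nat)%C with ((Csum b (S L) - b 0%nat) + b (S L))%C by ring.
      eapply Rle_trans; [apply Cmod_triangle|]. specialize (Hb L). simpl pow in *. lra. }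
  assert (Hlow : forall L, r ^ m * eta <= Cmod (Csum b (S L))).
  { intros L. specialize (Htail L).
    assert (Hb0 : Cmod (b 0%nat) = 2 * eta * r ^ m).
    { unfold b. rewrite Nat.mul_0_r, Nat.add_0_l, Cmod_mult, Cmod_R, Rabs_pos_eq by (apply pow_le; lra).
      unfold eta. field. }
    pose proof (Cmod_triangle (Csum b (S L)) (- (Csum b (S L) - b 0%nat))%C) as T.
    replace (Csum b (S L) + - (Csum b (S L) - b 0%nat))%C with (b 0%nat) in T by ring.
    rewrite Cmod_opp in T.
    assert (0 < (1 / 2) ^ L) by (apply pow_lt; lra).
    assert (0 <= eta * r ^ m * (1 / 2) ^ L).
    { apply Rmult_le_pos; [apply Rmult_le_pos|]; unfold eta; lra. }
    lra. }
  assert (Hpt : forall j, in_disk (RtoC r * root N ^ j)%C /\ (RtoC r * root N ^ j)%C <> RtoC 0).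
  { intros j. assert (E : Cmod (RtoC r * root N ^ j)%C = r).
    { rewrite Cmod_mult, Cmod_root_pow, Cmod_R, Rabs_pos_eq; lra. }
    split; [unfold in_disk|apply Cmod_gt_0]; rewrite E; lra. }
  (* The Taylor series converges only pointwise, but a ring has finitely many points: one partial
     sum, whose length is a multiple of [N], is [eps]-close at all of them. *)
  assert (Heps : forall eps, 0 < eps ->
    INR N * ((1 / 2) ^ m * eta) <= Rsum (fun j => Cmod (f (RtoC r * root N ^ j)%C)) N + INR N * eps).
  { intros eps He.
    destruct (eventually_forall_lt (fun j n => Cmod (Csum (fun k => a k * (RtoC r * root N ^ j) ^ k) n
        - f (RtoC r * root N ^ j))%C < eps) N) as [n0 Hn0].
    { intros j. apply Hconv; trivial; apply Hpt. }
    specialize (Hn0 (N * S n0)%nat ltac:(nia)).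
    rewrite <- Rsum_plus_const.
    apply Rle_trans with (Rsum (fun j => Cmod ((root N ^ (N - m)) ^ j *
       Csum (fun k => a k * (RtoC r * root N ^ j) ^ k) (N * S n0))%C) N).
    - eapply Rle_trans; [|apply Cmod_Csum_le].
      rewrite sample_polynomial by lia. fold b.
      rewrite Cmod_mult, Cmod_R, Rabs_pos_eq by lra.
      apply Rmult_le_compat_l; [lra|].
      eapply Rle_trans; [|apply Hlow]. apply Rmult_le_compat_r; [unfold eta; lra|trivial].
    - apply Rsum_le. intros j Hj. specialize (Hn0 j Hj).
      rewrite Cmod_mult, <- Cpow_mult_r, Cmod_root_pow, Rmult_1_l.
      set (w := (RtoC r * root N ^ j)%C) in *.
      set (P := Csum (fun k => a k * w ^ k)%C (N * S n0)) in *.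
      pose proof (Cmod_triangle (P - f w)%C (f w)) as T.
      replace (P - f w + f w)%C with P in T by ring. lra. }
  apply le_epsilon. intros eps He.
  specialize (Heps (eps / INR N) ltac:(apply Rdiv_lt_0_compat; trivial)).
  replace (INR N * (eps / INR N)) with eps in Heps by (field; lra). exact Heps.
Qed.

(** * Arranging points level by level *)

(** Lists the pairs [(l, j)] with [j < c l] in lexicographic order. On leaving a level it moves to
    [(S l, 0)] unconditionally, so it is correct only when every level is nonempty. *)
Fixpoint slot (c : nat -> nat) (k : nat) : nat * nat :=
  match k with
  | O => (O, O)
  | S k' => let (l, j) := slot c k' in
            if Nat.ltb (S j) (c l) then (l, S j) else (S l, O)
  end.

Fixpoint start (c : nat -> nat) (l : nat) : nat :=
  match l with O => O | S l' => (start c l' + c l')%nat end.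

Lemma slot_spec (c : nat -> nat) (k : nat) :
  (forall l, (0 < c l)%nat) ->
  (start c (fst (slot c k)) + snd (slot c k) = k)%nat /\ (snd (slot c k) < c (fst (slot c k)))%nat.
Proof.
  intros Hc. induction k as [|k [IH1 IH2]]; [split; [reflexivity|apply Hc]|].
  cbn [slot]. destruct (slot c k) as [l j]. simpl in IH1, IH2.
  destruct (Nat.ltb_spec (S j) (c l)) as [H|H]; simpl; [lia|].
  specialize (Hc (S l)). lia.
Qed.

Lemma slot_inj (c : nat -> nat) (k k' : nat) :
  (forall l, (0 < c l)%nat) -> slot c k = slot c k' -> k = k'.
Proof.
  intros Hc E. destruct (slot_spec c k Hc) as [<- _]. destruct (slot_spec c k' Hc) as [<- _].
  rewrite E. reflexivity.
Qed.

Lemma start_mono (c : nat -> nat) (l l' : nat) : (l <= l')%nat -> (start c l <= start c l')%nat.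
Proof. intros H. induction H; simpl; lia. Qed.

Lemma start_ge (c : nat -> nat) (l : nat) : (forall l, (0 < c l)%nat) -> (l <= start c l)%nat.
Proof.
  intros Hc. induction l as [|l IH]; simpl; [lia|]. specialize (Hc l). lia.
Qed.

Lemma slot_start (c : nat -> nat) (l j : nat) :
  (forall l, (0 < c l)%nat) -> (j < c l)%nat -> slot c (start c l + j) = (l, j).
Proof.
  intros Hc Hj. destruct (slot_spec c (start c l + j) Hc) as [H1 H2].
  destruct (slot c (start c l + j)) as [l' j']. simpl in H1, H2.
  destruct (Nat.lt_trichotomy l l') as [H|[->|H]].
  - apply (start_mono c) in H. simpl in H. lia.
  - f_equal. lia.
  - apply (start_mono c) in H. simpl in H. lia.
Qed.

Lemma slot_level_ge (c : nat -> nat) (l k : nat) :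
  (forall l, (0 < c l)%nat) -> (start c l <= k)%nat -> (l <= fst (slot c k))%nat.
Proof.
  intros Hc Hk. destruct (slot_spec c k Hc) as [H1 H2].
  apply Nat.nlt_ge. intros H. apply (start_mono c) in H. simpl in H. lia.
Qed.

Lemma Rsum_ext (u v : nat -> R) (n : nat) :
  (forall k, (k < n)%nat -> u k = v k) -> Rsum u n = Rsum v n.
Proof.
  intros H. apply Rle_antisym; apply Rsum_le; intros k Hk; rewrite H; trivial; lra.
Qed.

Lemma Rsum_add (u : nat -> R) (m n : nat) :
  Rsum u (m + n) = Rsum u m + Rsum (fun k => u (m + k)%nat) n.
Proof.
  induction n as [|n IH]; cbn [Rsum]; [rewrite Nat.add_0_r; ring|].
  rewrite Nat.add_succ_r. cbn [Rsum]. rewrite IH. ring.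
Qed.

Lemma Rsum_scal (u : nat -> R) (c : R) (n : nat) : Rsum (fun k => c * u k) n = c * Rsum u n.
Proof.
  induction n as [|n IH]; cbn [Rsum]; [ring|]. rewrite IH. ring.
Qed.

Lemma Rsum_const (c : R) (n : nat) : Rsum (fun _ => c) n = INR n * c.
Proof.
  induction n as [|n IH]; cbn [Rsum]; [simpl; ring|]. rewrite IH, S_INR. ring.
Qed.

Lemma Rsum_nonneg (u : nat -> R) (n : nat) : (forall k, 0 <= u k) -> 0 <= Rsum u n.
Proof. intros H. apply (Rsum_le_mono u 0 n H). lia. Qed.

Lemma Rsum_slot (c : nat -> nat) (u : nat * nat -> R) (n : nat) :
  (forall l, (0 < c l)%nat) ->
  Rsum (fun k => u (slot c k)) (start c n) = Rsum (fun l => Rsum (fun j => u (l, j)) (c l)) n.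
Proof.
  intros Hc. induction n as [|n IH]; [reflexivity|].
  cbn [start]. rewrite Rsum_add, IH. cbn [Rsum]. f_equal.
  apply Rsum_ext. intros j Hj. rewrite slot_start; trivial.
Qed.

(** * Selecting levels *)

(** The total kept among the first [n] terms. The test refers to this total itself, so the sum is
    defined first and the selecting predicate is read off from it. *)
Fixpoint mass (w eps : nat -> R) (n : nat) : R :=
  match n with
  | O => 0
  | S m => mass w eps m + (if Rle_dec (eps m) (/ (1 + mass w eps m) ^ 2) then w m else 0)
  end.

(* A term is kept when [eps] is below [1 / (1 + s)^2], [s] being the mass kept so far:
   the [eps]-weighted sum is then dominated by the integral of [1 / (1 + s)^2], while a bounded
   kept mass would eventually let every term through. *)
Lemma sparse_selection (w eps : nat -> R) (K : R) :
  (forall n, 0 <= w n <= K) ->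
  (forall e, 0 < e -> exists n0, forall n, (n0 <= n)%nat -> eps n <= e) ->
  (forall B, exists n, B <= Rsum w n) ->
  exists p : nat -> bool,
    (forall B, exists n, B <= Rsum (fun l => if p l then w l else 0) n) /\
    (forall n, Rsum (fun l => if p l then w l * eps l else 0) n <= 1 + K).
Proof.
  intros Hw Heps Hdiv.
  set (s := mass w eps).
  set (p := fun n => if Rle_dec (eps n) (/ (1 + s n) ^ 2) then true else false).
  exists p.
  assert (Es : forall n, Rsum (fun l => if p l then w l else 0) n = s n).
  { induction n as [|n IH]; [reflexivity|]. cbn [Rsum]. rewrite IH.
    unfold s at 2. cbn [mass]. fold s. unfold p. destruct Rle_dec; reflexivity. }
  assert (Hs : forall n, 0 <= s n).
  { intros n. rewrite <- Es. apply Rsum_nonneg. intros k. destruct (p k); [apply Hw|lra]. }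
  assert (HK : 0 <= K) by (specialize (Hw 0%nat); lra).
  split.
  - apply NNPP. intros Hno.
    assert (HB : exists B, forall n, s n < B).
    { apply NNPP. intros Hn. apply Hno. intros B. apply NNPP. intros Hn'. apply Hn.
      exists B. intros n. apply Rnot_le_lt. intros Hle. apply Hn'. exists n. rewrite Es. trivial. }
    destruct HB as [B HB].
    pose proof (Hs 0%nat) as Hs0. pose proof (HB 0%nat) as HB0.
    destruct (Heps (/ (1 + B) ^ 2)) as [n0 Hn0].
    { apply Rinv_0_lt_compat, pow_lt. lra. }
    (* If the kept mass stayed below [B], its threshold would stay above [1 / (1 + B)^2], which
       [eps] eventually undercuts. *)
    assert (Hp : forall n, (n0 <= n)%nat -> p n = true).
    { intros n Hn. unfold p. destruct Rle_dec as [|Hf]; trivial. exfalso. apply Hf.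
      eapply Rle_trans; [apply Hn0; trivial|].
      specialize (Hs n). specialize (HB n).
      apply Rinv_le_contravar; [apply pow_lt; lra|]. apply pow_incr. lra. }
    assert (Htail : forall k, s (n0 + k)%nat = s n0 + (Rsum w (n0 + k) - Rsum w n0)).
    { intros k. rewrite <- !Es. rewrite !Rsum_add.
      rewrite (Rsum_ext (fun k => if p (n0 + k)%nat then w (n0 + k)%nat else 0) (fun k => w (n0 + k)%nat)).
      - ring.
      - intros i _. rewrite Hp by lia. reflexivity. }
    destruct (Hdiv (B + Rsum w n0)) as [n Hn].
    assert (Hm : Rsum w n <= Rsum w (n0 + n)) by (apply Rsum_le_mono; [intros; apply Hw|lia]).
    specialize (Htail n). specialize (HB (n0 + n)%nat). specialize (Hs n0). lra.
  - assert (H : forall n, Rsum (fun l => if p l then w l * eps l else 0) n <= (1 + K) * (1 - / (1 + s n))).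
    { induction n as [|n IH]; [simpl; rewrite Rplus_0_r, Rinv_1; lra|].
      cbn [Rsum].
      assert (E : s (S n) = s n + if p n then w n else 0) by (rewrite <- !Es; reflexivity).
      rewrite E. specialize (Hs n). specialize (Hw n).
      unfold p at 2 3. destruct Rle_dec as [Hle|_]; [|rewrite !Rplus_0_r; lra].
      assert (w n * eps n <= (1 + K) * (/ (1 + s n) - / (1 + (s n + w n)))).
      { apply Rle_trans with (w n * / (1 + s n) ^ 2); [apply Rmult_le_compat_l; lra|].
        replace ((1 + K) * (/ (1 + s n) - / (1 + (s n + w n))))
          with (w n * ((1 + K) * / ((1 + s n) * (1 + (s n + w n))))) by (field; lra).
        apply Rmult_le_compat_l; [lra|].
        apply Rmult_le_reg_r with ((1 + s n) ^ 2 * (1 + (s n + w n))); [nra|].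
        replace (/ (1 + s n) ^ 2 * ((1 + s n) ^ 2 * (1 + (s n + w n)))) with (1 + (s n + w n))
          by (field; lra).
        replace ((1 + K) * / ((1 + s n) * (1 + (s n + w n))) * ((1 + s n) ^ 2 * (1 + (s n + w n))))
          with ((1 + K) * (1 + s n)) by (field; lra).
        nra. }
      lra. }
    intros n. eapply Rle_trans; [apply H|]. specialize (Hs n).
    pose proof (Rinv_0_lt_compat (1 + s n) ltac:(lra)). nra.
Qed.

(** * Dyadic rings of points *)

(* Starting at [1 / 2] keeps the origin off the rings. *)
Definition gap (l : nat) : R := (1 / 2) ^ S l.

Definition ring_point (q : nat * nat) : C :=
  (RtoC (1 - gap (fst q)) * root (2 ^ S (fst q)) ^ snd q)%C.

Lemma gap_range (l : nat) : 0 < gap l <= 1 / 2.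
Proof.
  unfold gap. split; [apply pow_lt; lra|]. simpl.
  assert ((1 / 2) ^ l <= 1 ^ l) by (apply pow_incr; lra). rewrite pow1 in *. lra.
Qed.

Lemma gap_S (l : nat) : gap (S l) = gap l / 2.
Proof. unfold gap. simpl. field. Qed.

Lemma INR_pow2_gap (l : nat) : INR (2 ^ S l) * gap l = 1.
Proof.
  unfold gap. rewrite pow_INR, <- Rpow_mult_distr.
  replace (INR 2 * (1 / 2)) with 1 by (simpl; field). apply pow1.
Qed.

Lemma gap_lt (l l' : nat) : (l < l')%nat -> gap l' <= gap l / 2.
Proof.
  intros H. induction H as [|l' _ IH]; rewrite gap_S; [lra|].
  pose proof (gap_range l'). lra.
Qed.

Lemma Cmod_ring_point (q : nat * nat) : Cmod (ring_point q) = 1 - gap (fst q).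
Proof.
  unfold ring_point. pose proof (gap_range (fst q)).
  rewrite Cmod_mult, Cmod_root_pow, Cmod_R, Rabs_pos_eq; lra.
Qed.

Lemma gap_small (e : R) : 0 < e -> exists n0, forall l, (n0 <= l)%nat -> gap l < e.
Proof.
  intros He. destruct (half_pow_lt 1 e He) as [n0 Hn]. exists (S n0). intros l Hl.
  destruct l as [|l]; [lia|]. assert (H := gap_lt n0 (S l) Hl). pose proof (gap_range n0).
  apply Rle_lt_trans with (2 := Hn). unfold gap at 2 in H. simpl in H.
  rewrite Rdiv_1_l, <- pow_inv. replace (/ 2) with (1 / 2) by field.
  assert (0 < (1 / 2) ^ n0) by (apply pow_lt; lra). lra.
Qed.

(** Write [t] for the gap and [N] for the exponent, so [N t = 1]. Bernoulli gives [(1 + t)^N >= 2],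
    and [(1 - t)^N (1 + t)^N <= 1]. *)
Lemma one_minus_gap_pow (l : nat) : (1 - gap l) ^ (2 ^ S l) <= 1 / 2.
Proof.
  pose proof (gap_range l). set (t := gap l) in *. set (N := (2 ^ S l)%nat).
  assert (H1 : 1 + INR N * t <= (1 + t) ^ N) by (apply poly; lra).
  assert (E : INR N * t = 1) by apply INR_pow2_gap.
  assert (H2 : (1 - t) ^ N * (1 + t) ^ N <= 1).
  { rewrite <- Rpow_mult_distr. apply Rle_trans with (1 ^ N); [|rewrite pow1; lra].
    apply pow_incr. nra. }
  assert (0 <= (1 - t) ^ N) by (apply pow_le; lra).
  nra.
Qed.

(** By the identity [|1 - conj(a) b|^2 = |a - b|^2 + (1 - |a|^2)(1 - |b|^2)], the hypothesis bounds
    the squared denominator by [17 |a - b|^2], and [17 < 25]. *)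
Lemma pseudo_dist_lower (a b : C) :
  in_disk a -> in_disk b ->
  (1 - Cmod a ^ 2) * (1 - Cmod b ^ 2) <= 16 * Cmod (a - b)%C ^ 2 -> 1 / 5 <= pseudo_dist a b.
Proof.
  unfold in_disk, pseudo_dist. intros Ha Hb H.
  assert (E : Cmod (1 - Cconj a * b)%C ^ 2 = Cmod (a - b)%C ^ 2 + (1 - Cmod a ^ 2) * (1 - Cmod b ^ 2)).
  { rewrite !Cmod2_alt. destruct a as [a1 a2], b as [b1 b2]. simpl. ring. }
  pose proof (Cmod_ge_0 a). pose proof (Cmod_ge_0 b).
  assert (HY : 0 < (1 - Cmod a ^ 2) * (1 - Cmod b ^ 2)) by (apply Rmult_lt_0_compat; nra).
  pose proof (Cmod_ge_0 (1 - Cconj a * b)%C) as HD.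
  pose proof (Cmod_ge_0 (a - b)%C) as HX.
  assert (HDpos : 0 < Cmod (1 - Cconj a * b)%C) by nra.
  rewrite Cmod_div by (apply Cmod_gt_0; trivial).
  apply Rmult_le_reg_r with (Cmod (1 - Cconj a * b)%C); trivial.
  unfold Rdiv at 2. rewrite Rmult_assoc, Rinv_l, Rmult_1_r by lra.
  apply Rsqr_incr_0_var; trivial. unfold Rsqr. nra.
Qed.

(** An algebraic substitute for a bound on the sine: the numbers [1 - zeta^j] for [j < N] add up to
    [N], and each has modulus at most [j |1 - zeta|]. *)
Lemma root_pow_dist (N k : nat) : (0 < k < N)%nat -> 1 <= INR N * Cmod (1 - root N ^ k)%C.
Proof.
  intros Hk. set (zeta := (root N ^ k)%C).
  assert (Hpow : forall j, Cmod (1 - zeta ^ j)%C <= INR j * Cmod (1 - zeta)%C).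
  { induction j as [|j IH].
    - simpl. replace (1 - 1)%C with (RtoC 0) by ring. rewrite Cmod_0. lra.
    - replace (1 - zeta ^ S j)%C with ((1 - zeta ^ j) + zeta ^ j * (1 - zeta))%C by (simpl; ring).
      eapply Rle_trans; [apply Cmod_triangle|].
      unfold zeta at 2. rewrite <- Cpow_mult_r, Cmod_mult, Cmod_root_pow, S_INR. lra. }
  assert (E : Csum (fun j => 1 - zeta ^ j)%C N = RtoC (INR N)).
  { rewrite (Csum_ext _ (fun j => (root N ^ N) ^ j + RtoC (-1) * zeta ^ j)%C).
    - rewrite Csum_plus, Csum_mult_l. unfold zeta. rewrite !Csum_root_pow by lia.
      destruct (Nat.eq_dec N N) as [_|]; [|lia]. destruct (Nat.eq_dec k N); [lia|]. ring.
    - intros j _. rewrite root_pow_N, Cpow_1_l by lia.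
      apply injective_projections; simpl; ring. }
  pose proof (Cmod_Csum_le (fun j => 1 - zeta ^ j)%C N) as Hle.
  pose proof (pos_INR N) as HN0.
  rewrite E, Cmod_R, Rabs_pos_eq in Hle by trivial.
  assert (Hle2 : Rsum (fun j => Cmod (1 - zeta ^ j)%C) N <= INR N * (INR N * Cmod (1 - zeta)%C)).
  { rewrite <- Rsum_const. apply Rsum_le. intros j Hj. eapply Rle_trans; [apply Hpow|].
    apply Rmult_le_compat_r; [apply Cmod_ge_0|]. apply le_INR. lia. }
  assert (0 < INR N) by (apply lt_0_INR; lia).
  apply Rmult_le_reg_l with (INR N); trivial. lra.
Qed.

Lemma ring_point_in_disk (q : nat * nat) : in_disk (ring_point q).
Proof.
  unfold in_disk. rewrite Cmod_ring_point. pose proof (gap_range (fst q)). lra.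
Qed.

Lemma Cmod_minus_sym (a b : C) : Cmod (a - b)%C = Cmod (b - a)%C.
Proof. rewrite <- Cmod_opp. f_equal. ring. Qed.

Lemma ring_points_same_level (l i j : nat) :
  (i < j < 2 ^ S l)%nat -> gap l / 2 <= Cmod (ring_point (l, i) - ring_point (l, j))%C.
Proof.
  intros Hij. unfold ring_point. cbn [fst snd].
  replace (root (2 ^ S l) ^ j)%C with (root (2 ^ S l) ^ i * root (2 ^ S l) ^ (j - i))%C
    by (rewrite <- Cpow_add_r; f_equal; lia).
  set (N := (2 ^ S l)%nat) in *.
  replace (RtoC (1 - gap l) * root N ^ i - RtoC (1 - gap l) * (root N ^ i * root N ^ (j - i)))%C
    with (RtoC (1 - gap l) * (root N ^ i * (1 - root N ^ (j - i))))%C by ring.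
  pose proof (gap_range l).
  rewrite !Cmod_mult, Cmod_root_pow, Cmod_R, Rabs_pos_eq, Rmult_1_l by lra.
  pose proof (root_pow_dist N (j - i) ltac:(lia)) as H1.
  pose proof (INR_pow2_gap l) as H2. fold N in H2.
  set (D := Cmod (1 - root N ^ (j - i))%C) in *.
  assert (H3 : gap l <= D).
  { assert (HN : 0 < INR N) by (apply lt_0_INR; lia).
    apply Rmult_le_reg_l with (INR N); trivial. lra. }
  nra.
Qed.

Lemma ring_points_separated (q q' : nat * nat) :
  (snd q < 2 ^ S (fst q))%nat -> (snd q' < 2 ^ S (fst q'))%nat -> q <> q' ->
  1 / 5 <= pseudo_dist (ring_point q) (ring_point q').
Proof.
  intros Hq Hq' Hne.
  assert (Hlev : forall q q', (fst q < fst q')%nat -> gap (fst q) / 2 <= Cmod (ring_point q - ring_point q')%C).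
  { clear. intros q q' H. apply gap_lt in H.
    pose proof (Cmod_triangle (ring_point q' - ring_point q)%C (ring_point q)) as T.
    replace (ring_point q' - ring_point q + ring_point q)%C with (ring_point q') in T by ring.
    rewrite (Cmod_minus_sym (ring_point q')), !Cmod_ring_point in T. lra. }
  apply pseudo_dist_lower; try apply ring_point_in_disk.
  rewrite !Cmod_ring_point.
  set (d := Cmod (ring_point q - ring_point q')%C).
  destruct q as [l i], q' as [l' j]. cbn [fst snd] in *.
  pose proof (gap_range l). pose proof (gap_range l').
  assert (B1 : 0 <= 1 - (1 - gap l) ^ 2 <= 2 * gap l) by nra.
  assert (B2 : 0 <= 1 - (1 - gap l') ^ 2 <= 2 * gap l') by nra.
  assert (B3 : (1 - (1 - gap l) ^ 2) * (1 - (1 - gap l') ^ 2) <= (2 * gap l) * (2 * gap l'))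
    by (apply Rmult_le_compat; lra).
  (* On different levels the radial distance is at least half of the larger gap. Both bounds
     together give [4 gap l gap l' <= 16 d^2], the form that [pseudo_dist_lower] asks for. *)
  assert (Hd : gap l / 2 <= d /\ gap l' / 2 <= d).
  { destruct (Nat.lt_trichotomy l l') as [H1|[->|H1]].
    - specialize (Hlev (l, i) (l', j) H1). apply gap_lt in H1. simpl in Hlev. fold d in Hlev. lra.
    - destruct (Nat.lt_trichotomy i j) as [H1|[->|H1]]; [| congruence |].
      + pose proof (ring_points_same_level l' i j ltac:(lia)). fold d in H2. lra.
      + pose proof (ring_points_same_level l' j i ltac:(lia)).
        rewrite Cmod_minus_sym in H2. fold d in H2. lra.
    - specialize (Hlev (l', j) (l, i) H1). apply gap_lt in H1. rewrite Cmod_minus_sym in Hlev.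
      simpl in Hlev. fold d in Hlev. lra. }
  assert (gap l / 2 * (gap l' / 2) <= d * d) by (apply Rmult_le_compat; lra).
  simpl pow in *. lra.
Qed.

(** * The integral condition on dyadic levels *)

Lemma rho_pos (theta : R -> R) (t : R) : 0 < t -> 0 < rho theta t.
Proof. intros H. unfold rho. apply Rmult_lt_0_compat; trivial. apply exp_pos. Qed.

Lemma ex_RInt_rho (theta : R -> R) (a b : R) :
  (forall t : R, 0 < t < 1 -> continuous (rho theta) t) -> 0 < a -> a <= b -> b < 1 ->
  ex_RInt (fun t => rho theta t / t ^ 2) a b.
Proof.
  intros Hc Ha Hab Hb. apply (ex_RInt_continuous (V := R_CompleteNormedModule)).
  intros t Ht. rewrite Rmin_left, Rmax_right in Ht by trivial.
  apply (continuous_mult (K := R_AbsRing) (rho theta) (fun t => / t ^ 2)); [apply Hc; lra|].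
  apply (ex_derive_continuous (V := R_NormedModule)). auto_derive. apply Rgt_not_eq. nra.
Qed.

Lemma dyadic_sum_diverges (theta : R -> R) :
  (forall t : R, 0 < t < 1 -> continuous (rho theta) t) ->
  (forall s t : R, 0 < s -> s <= t -> t < 1 -> rho theta s <= rho theta t) ->
  integral_diverges_at_0 (fun t : R => rho theta t / t ^ 2) ->
  forall B, exists n, B <= Rsum (fun l => rho theta (gap l) / gap l) n.
Proof.
  intros Hc Hm [e0 [He0 Hint]] B.
  set (w := fun l => rho theta (gap l) / gap l).
  set (g := fun t : R => rho theta t / t ^ 2) in *.
  destruct (gap_small e0 ltac:(lra)) as [n0 Hn0]. specialize (Hn0 n0 (le_n _)).
  assert (Hw : forall l, 0 <= w l).
  { intros l. pose proof (gap_range l). left. apply Rdiv_lt_0_compat; [apply rho_pos|]; lra. }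
  (* On a dyadic block the numerator is at most its value at the right end and [t^2] at least its
     value at the left end; the block has length [gap l / 2]. *)
  assert (Hstep : forall l, RInt g (gap (S l)) (gap l) <= 2 * w l).
  { intros l. pose proof (gap_range l) as Hl. rewrite gap_S.
    replace (2 * w l) with (RInt (V := R_CompleteNormedModule) (fun _ => 4 * w l / gap l) (gap l / 2) (gap l))
      by (rewrite RInt_const; unfold scal; simpl; unfold mult; simpl; field; lra).
    apply RInt_le; [lra|apply ex_RInt_rho; trivial; lra|apply ex_RInt_const|].
    intros t Ht. unfold g, w.
    replace (4 * (rho theta (gap l) / gap l) / gap l) with (rho theta (gap l) * / (gap l / 2) ^ 2)
      by (field; lra).
    apply Rmult_le_compat.
    - left. apply rho_pos. lra.
    - left. apply Rinv_0_lt_compat, pow_lt. lra.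
    - apply Hm; lra.
    - apply Rinv_le_contravar; [apply pow_lt; lra|]. apply pow_incr. lra. }
  assert (Hsum : forall k, RInt g (gap (n0 + k)) (gap n0) <= 2 * Rsum w (n0 + k)).
  { induction k as [|k IH].
    - rewrite Nat.add_0_r, RInt_point. pose proof (Rsum_nonneg w n0 Hw).
      change (zero (G := R_CompleteNormedModule)) with 0. lra.
    - rewrite Nat.add_succ_r. cbn [Rsum].
      pose proof (gap_range (n0 + k)) as R1. pose proof (gap_range n0) as R2.
      assert (Hle : gap (n0 + k) <= gap n0).
      { destruct k as [|k]; [rewrite Nat.add_0_r; lra|].
        assert (H := gap_lt n0 (n0 + S k) ltac:(lia)). lra. }
      rewrite <- (RInt_Chasles (V := R_CompleteNormedModule) g _ (gap (n0 + k))).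
      + specialize (Hstep (n0 + k)%nat). unfold plus; simpl. lra.
      + rewrite gap_S. apply ex_RInt_rho; trivial; lra.
      + apply ex_RInt_rho; trivial; lra. }
  pose proof (gap_range n0) as R0.
  destruct (Hint (gap n0) ltac:(lra) (fun x => 2 * B < x)) as [d Hd].
  { exists (2 * B). trivial. }
  destruct (gap_small d (cond_pos d)) as [n1 Hn1].
  specialize (Hn1 (n0 + n1)%nat ltac:(lia)).
  pose proof (gap_range (n0 + n1)) as R1.
  exists (n0 + n1)%nat. specialize (Hsum n1).
  assert (2 * B < RInt g (gap (n0 + n1)) (gap n0)); [|lra].
  apply Hd; [|lra].
  change (Rabs (gap (n0 + n1) - 0) < d). rewrite Rminus_0_r, Rabs_pos_eq; lra.
Qed.

Lemma gap_sum (n : nat) : Rsum gap n <= 1.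
Proof.
  assert (E : Rsum gap n = 1 - (1 / 2) ^ n).
  { induction n as [|n IH]; [simpl; ring|]. cbn [Rsum]. rewrite IH. unfold gap. simpl. field. }
  rewrite E. assert (0 < (1 / 2) ^ n) by (apply pow_lt; lra). lra.
Qed.

Lemma eventually_le_bounded (u : nat -> R) (b : R) (n0 : nat) :
  (forall n, 0 <= u n) -> (forall n, (n0 <= n)%nat -> u n <= b) ->
  exists B, forall n, u n <= B.
Proof.
  intros Hu Hn. exists (Rmax b (Rsum u n0)). intros n.
  destruct (Nat.lt_ge_cases n n0) as [H|H].
  - apply Rle_trans with (2 := Rmax_r _ _). apply Rle_trans with (Rsum u (S n)).
    + simpl. pose proof (Rsum_nonneg u n Hu). lra.
    + apply Rsum_le_mono; trivial.
  - apply Rle_trans with (2 := Rmax_l _ _). auto.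
Qed.

Lemma rho_quotient_small (theta1 theta2 : R -> R) :
  filterlim (fun t : R => rho theta1 t / rho theta2 t) (at_right 0) (Rbar_locally p_infty) ->
  forall e, 0 < e -> exists n0, forall l, (n0 <= l)%nat ->
    rho theta2 (gap l) / rho theta1 (gap l) <= e.
Proof.
  intros H e He.
  destruct (H (fun x => / e < x)) as [d Hd]; [exists (/ e); trivial|].
  destruct (gap_small d (cond_pos d)) as [n0 Hn0]. exists n0. intros l Hl.
  pose proof (gap_range l) as Hg.
  assert (Hb : / e < rho theta1 (gap l) / rho theta2 (gap l)).
  { apply Hd; [|lra]. change (Rabs (gap l - 0) < d).
    rewrite Rminus_0_r, Rabs_pos_eq by lra. auto. }
  pose proof (rho_pos theta1 (gap l) ltac:(lra)) as P1.
  pose proof (rho_pos theta2 (gap l) ltac:(lra)) as P2.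
  rewrite <- (Rinv_inv e). rewrite <- Rinv_div.
  apply Rinv_le_contravar; [apply Rinv_0_lt_compat; trivial|lra].
Qed.

(** * The ring sequence of a set of levels and its weighted sums *)

Definition level_size (p : nat -> bool) (l : nat) : nat := if p l then (2 ^ S l)%nat else 1%nat.

Definition ring_sequence (p : nat -> bool) (k : nat) : C := ring_point (slot (level_size p) k).

Lemma level_size_pos (p : nat -> bool) (l : nat) : (0 < level_size p l)%nat.
Proof.
  unfold level_size. destruct (p l); [|lia]. apply Nat.neq_0_lt_0, Nat.pow_nonzero. lia.
Qed.

Lemma level_size_le (p : nat -> bool) (l : nat) : (level_size p l <= 2 ^ S l)%nat.
Proof.
  unfold level_size. destruct (p l); [lia|].
  apply Nat.neq_0_lt_0, Nat.pow_nonzero. lia.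
Qed.

Lemma disk_ring_sequence (p : nat -> bool) : disk_sequence (ring_sequence p).
Proof.
  split; [intros k; apply ring_point_in_disk|].
  apply is_lim_seq_spec. intros e.
  destruct (gap_small e (cond_pos e)) as [n0 Hn0].
  exists (start (level_size p) n0). intros k Hk.
  unfold ring_sequence. rewrite Cmod_ring_point.
  specialize (Hn0 _ (slot_level_ge _ _ _ (level_size_pos p) Hk)).
  pose proof (gap_range (fst (slot (level_size p) k))).
  rewrite Rabs_left; lra.
Qed.

Lemma separated_ring_sequence (p : nat -> bool) : separated (ring_sequence p).
Proof.
  unfold separated.
  match goal with |- context [Glb_Rbar ?E] => destruct (Glb_Rbar_correct E) as [_ Hglb] end.
  apply Rbar_lt_le_trans with (1 / 5); [simpl; lra|].
  apply Hglb. intros d [n [k [Hnk ->]]]. simpl.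
  pose proof (slot_spec _ n (level_size_pos p)) as [_ Hn].
  pose proof (slot_spec _ k (level_size_pos p)) as [_ Hk].
  apply ring_points_separated.
  - eapply Nat.lt_le_trans; [exact Hn|apply level_size_le].
  - eapply Nat.lt_le_trans; [exact Hk|apply level_size_le].
  - intros E. apply Hnk. exact (slot_inj _ _ _ (level_size_pos p) E).
Qed.

Lemma weighted_term_ring (theta : R -> R) (f : C -> C) (p : nat -> bool) (k : nat) :
  let q := slot (level_size p) k in
  weighted_term theta f (ring_sequence p) k = rho theta (gap (fst q)) * Cmod (f (ring_point q)).
Proof.
  intros q. unfold weighted_term, ring_sequence. fold q.
  pose proof (gap_range (fst q)). pose proof (Cmod_ring_point q) as E.
  destruct Ceq_dec as [Hz|_].
  - rewrite Hz, Cmod_0 in E. lra.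
  - rewrite E. do 2 f_equal. ring.
Qed.

Lemma weighted_term_ge0 (theta : R -> R) (f : C -> C) (p : nat -> bool) (k : nat) :
  0 <= weighted_term theta f (ring_sequence p) k.
Proof.
  rewrite weighted_term_ring. apply Rmult_le_pos; [|apply Cmod_ge_0].
  left. apply rho_pos. apply gap_range.
Qed.

Lemma weighted_sum_levels (theta : R -> R) (f : C -> C) (p : nat -> bool) (n : nat) :
  Rsum (weighted_term theta f (ring_sequence p)) (start (level_size p) n)
  = Rsum (fun l => rho theta (gap l) *
      Rsum (fun j => Cmod (f (ring_point (l, j)))) (level_size p l)) n.
Proof.
  set (u := fun q : nat * nat => rho theta (gap (fst q)) * Cmod (f (ring_point q))).
  transitivity (Rsum (fun k => u (slot (level_size p) k)) (start (level_size p) n)).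
  - apply Rsum_ext. intros k _. apply weighted_term_ring.
  - rewrite Rsum_slot by apply level_size_pos.
    apply Rsum_ext. intros l _. rewrite <- Rsum_scal. reflexivity.
Qed.

Lemma weighted_sum_finite_ring (theta : R -> R) (f : C -> C) (p : nat -> bool) (B : R) :
  H_infty f ->
  (forall n, Rsum (fun l => rho theta (gap l) * INR (level_size p l)) n <= B) ->
  weighted_sum_finite theta f (ring_sequence p).
Proof.
  intros [_ [M HM]] HB.
  assert (HM0 : 0 <= M).
  { eapply Rle_trans; [apply Cmod_ge_0|apply (HM (RtoC 0))]. unfold in_disk. rewrite Cmod_0. lra. }
  apply ex_series_Rsum_bounded with (M * B); [apply weighted_term_ge0|].
  intros n.
  (* Extending the partial sum to [n] complete levels makes the level-by-level formula
     applicable. *)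
  eapply Rle_trans; [apply Rsum_le_mono; [apply weighted_term_ge0|apply (start_ge _ n (level_size_pos p))]|].
  rewrite weighted_sum_levels.
  apply Rle_trans with (M * Rsum (fun l => rho theta (gap l) * INR (level_size p l)) n);
    [|apply Rmult_le_compat_l; auto].
  rewrite <- Rsum_scal. apply Rsum_le. intros l _.
  rewrite (Rmult_comm M), Rmult_assoc.
  apply Rmult_le_compat_l; [left; apply rho_pos, gap_range|].
  rewrite <- Rsum_const. apply Rsum_le. intros j _. apply HM, ring_point_in_disk.
Qed.

(** A selected ring carries [1 / gap l] points on which the mean of [|f|] is at least [delta], so it
    contributes at least [delta * rho (gap l) / gap l]. *)
Lemma not_thin_ring (theta : R -> R) (p : nat -> bool) :
  (forall B, exists n, B <= Rsum (fun l => if p l then rho theta (gap l) / gap l else 0) n) ->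
  ~ thin theta (ring_sequence p).
Proof.
  intros Hdiv [f [Hf [Hnz Hsum]]].
  destruct (sampling f Hf Hnz) as [delta [N0 [Hdelta Hs]]].
  apply ex_series_Rsum_le in Hsum; [|apply weighted_term_ge0].
  destruct Hsum as [B HB].
  set (w := fun l => if p l then rho theta (gap l) / gap l else 0) in *.
  assert (Hw : forall l, 0 <= w l).
  { intros l. unfold w. destruct (p l); [|lra]. pose proof (gap_range l).
    left. apply Rdiv_lt_0_compat; [apply rho_pos|]; lra. }
  set (V := fun l => rho theta (gap l) * Rsum (fun j => Cmod (f (ring_point (l, j)))) (level_size p l)).
  assert (HV0 : forall l, 0 <= V l).
  { intros l. apply Rmult_le_pos; [left; apply rho_pos, gap_range|].
    apply Rsum_nonneg. intros j. apply Cmod_ge_0. }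
  assert (HV : forall l, (N0 <= l)%nat -> delta * w l <= V l).
  { intros l Hl. unfold w. destruct (p l) eqn:Ep; [|rewrite Rmult_0_r; apply HV0].
    unfold V, level_size. rewrite Ep.
    pose proof (gap_range l) as Hg. pose proof (INR_pow2_gap l) as HN.
    assert (Hle : (N0 <= 2 ^ S l)%nat).
    { assert (S l < 2 ^ S l)%nat by (apply Nat.pow_gt_lin_r; lia). lia. }
    specialize (Hs (2 ^ S l)%nat (1 - gap l) Hle ltac:(lra) (one_minus_gap_pow l)).
    replace (delta * (rho theta (gap l) / gap l)) with (rho theta (gap l) * (INR (2 ^ S l) * delta)).
    - apply Rmult_le_compat_l; [left; apply rho_pos; lra|]. exact Hs.
    - replace (INR (2 ^ S l)) with (/ gap l); [field; lra|].
      apply Rmult_eq_reg_r with (gap l); [|lra]. rewrite HN, Rinv_l; lra. }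
  (* Sampling says nothing about levels below [N0]; their total weight is given away as a
     constant. *)
  assert (Hlow : forall n, delta * Rsum w n - delta * Rsum w N0 <= Rsum V n).
  { induction n as [|n IH].
    - simpl. pose proof (Rsum_nonneg w N0 Hw). nra.
    - destruct (Nat.lt_ge_cases n N0) as [H|H].
      + pose proof (Rsum_le_mono w (S n) N0 Hw H). pose proof (Rsum_nonneg V (S n) HV0). nra.
      + cbn [Rsum]. specialize (HV n H). lra. }
  destruct (Hdiv ((B + 1) / delta + Rsum w N0)) as [n Hn].
  specialize (Hlow n). specialize (HB (start (level_size p) n)).
  rewrite weighted_sum_levels in HB. fold V in HB.
  apply (Rmult_le_compat_l delta) in Hn; [|lra].
  replace (delta * ((B + 1) / delta + Rsum w N0)) with (B + 1 + delta * Rsum w N0) in Hn by (field; lra).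
  change (Rsum V n <= B) in HB. lra.
Qed.

Lemma H_infty_one : H_infty (fun _ => RtoC 1).
Proof.
  split.
  - intros z _. apply ex_derive_const.
  - exists 1. intros z _. rewrite Cmod_1. lra.
Qed.

Theorem proposition1p6 (theta1 theta2 : R -> R)
  (rho1_continuous : forall t : R, 0 < t < 1 -> continuous (rho theta1) t)
  (rho1_nondecreasing : forall s t : R, 0 < s -> s <= t -> t < 1 ->
     rho theta1 s <= rho theta1 t)
  (rho1_linear_bound : exists K : R, 0 < K /\
     forall t : R, 0 < t < 1 -> rho theta1 t <= K * t)
  (rho1_integral : integral_diverges_at_0 (fun t : R => rho theta1 t / t ^ 2))
  (rho_ratio : filterlim (fun t : R => rho theta1 t / rho theta2 t)
     (at_right 0) (Rbar_locally p_infty)) :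
  ~ (forall z : nat -> C, Lambda theta1 z <-> Lambda theta2 z) /\
  (exists z : nat -> C,
     disk_sequence z /\ separated z /\ ~ Lambda theta1 z /\
     forall f : C -> C, H_infty f -> weighted_sum_finite theta2 f z).
Proof.
  assert (Hex : exists z : nat -> C,
     disk_sequence z /\ separated z /\ ~ Lambda theta1 z /\
     forall f : C -> C, H_infty f -> weighted_sum_finite theta2 f z).
  { destruct rho1_linear_bound as [K [HK Hlin]].
    set (w := fun l => rho theta1 (gap l) / gap l).
    set (eps := fun l => rho theta2 (gap l) / rho theta1 (gap l)).
    assert (Hw : forall l, 0 <= w l <= K).
    { intros l. pose proof (gap_range l). split.
      - left. apply Rdiv_lt_0_compat; [apply rho_pos|]; lra.
      - apply Rle_div_l; [lra|]. apply Hlin. lra. }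
    assert (Heps0 : forall l, 0 <= eps l).
    { intros l. pose proof (gap_range l). left. apply Rdiv_lt_0_compat; apply rho_pos; lra. }
    assert (Heps := rho_quotient_small theta1 theta2 rho_ratio).
    destruct (sparse_selection w eps K Hw Heps
      (dyadic_sum_diverges theta1 rho1_continuous rho1_nondecreasing rho1_integral)) as [p [Hp1 Hp2]].
    destruct (Heps 1 Rlt_0_1) as [n0 Hn0].
    (* A bound on [rho_2 / rho_1] at all levels, needed for the single points on unselected levels:
       each costs at most [E * K * gap l], and the gaps are summable. *)
    destruct (eventually_le_bounded eps 1 n0 Heps0 Hn0) as [E HE].
    exists (ring_sequence p).
    split; [apply disk_ring_sequence|]. split; [apply separated_ring_sequence|]. split.
    - intros [_ [_ Hthin]]. revert Hthin. apply not_thin_ring. exact Hp1.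
    - intros f Hf. apply weighted_sum_finite_ring with (1 + K + E * K); trivial.
      assert (HEK : 0 <= E * K).
      { apply Rmult_le_pos; [|lra]. eapply Rle_trans; [apply (Heps0 0%nat)|apply HE]. }
      assert (Hsplit : forall n, Rsum (fun l => rho theta2 (gap l) * INR (level_size p l)) n
        <= Rsum (fun l => if p l then w l * eps l else 0) n + E * K * Rsum gap n).
      { induction n as [|n IH]; [simpl; lra|]. cbn [Rsum].
        pose proof (gap_range n) as Hg. pose proof (INR_pow2_gap n) as HN.
        pose proof (rho_pos theta1 (gap n) ltac:(lra)) as P1.
        assert (Hterm : rho theta2 (gap n) * INR (level_size p n)
          <= (if p n then w n * eps n else 0) + E * K * gap n).
        { unfold level_size. destruct (p n).
          (* On a selected ring [rho_1] cancels, so the product bounded by [sparse_selection] is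
             exactly the [rho_2]-weight of the ring. *)
          - assert (Eq : w n * eps n = rho theta2 (gap n) * INR (2 ^ S n)).
            { replace (INR (2 ^ S n)) with (/ gap n); [unfold w, eps; field; lra|].
              apply Rmult_eq_reg_r with (gap n); [|lra]. rewrite HN, Rinv_l; lra. }
            rewrite Eq. assert (0 <= E * K * gap n) by (apply Rmult_le_pos; lra). lra.
          - assert (Eq : rho theta2 (gap n) = eps n * rho theta1 (gap n)) by (unfold eps; field; lra).
            simpl INR. rewrite Rmult_1_r, Rplus_0_l, Eq, Rmult_assoc.
            apply Rmult_le_compat; try lra; auto. apply Hlin. lra. }
        lra. }
      intros n. eapply Rle_trans; [apply Hsplit|].
      specialize (Hp2 n). pose proof (gap_sum n). nra. }
  split; [|exact Hex].
  intros Heq. destruct Hex as [z [Hz [Hsep [Hn1 Hall]]]].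
  (* Summability for every bounded [f] applies in particular to the constant [1], which puts the
     sequence in the second class. *)
  apply Hn1, Heq. split; [|split]; trivial.
  exists (fun _ => RtoC 1). split; [exact H_infty_one|]. split; [|apply Hall, H_infty_one].
  exists (RtoC 0). split; [unfold in_disk; rewrite Cmod_0; lra|]. apply C1_nz.
Qed.
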